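(* Let $1<p<\infty$ with $p\ne2$. Then the group (under composition) of surjective linear isometries of $\widehat{X}_\omega$ onto itself is isomorphic to $$\{-1,1\}\times\prod_{k=1}^{\infty}\mathfrak{S}_{2^k},$$ where $\mathfrak{S}_{2^k}$ denotes the symmetric group on $2^k$ elements.
   Context: All function spaces are real and $\mathbb{N}=\{1,2,\dots\}$. For $n\in\mathbb{N}$, $\Omega_n=\{0,1\}^n$ carries the uniform probability measure $\mu_n$ (on its power set), and $H_n=\{f\in L^p(\Omega_n,\mu_n):\int_{\Omega_n}f\,d\mu_n=0\}$. Let $(\Omega,\Sigma,\mu)=\prod_{n=1}^\infty(\Omega_n,\mathcal{P}(\Omega_n),\mu_n)$ be the product probability space, $\pi_n\colon\Omega\to\Omega_n$ the $n$-th coordinate projection, and $J_n\colon L^p(\Omega_n,\mu_n)\to L^p(\Omega,\mu)$, $J_nf=f\circ\pi_n$. Let $X_\omega$ be the closure in $L^p(\Omega)$ of $\operatorname{span}\{J_n(H_n):n\in\mathbb{N}\}$, and $\widehat{X}_\omega=\mathbb{R}\mathbf{1}\oplus X_\omega\subseteq L^p(\Omega)$ its unitalization, with the $L^p(\Omega)$ norm; it is identified with the first limit Bourgain--Rosenthal--Schechtman space $R_\omega^p$. *)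

(* Defs.v *)
From HB Require Import structures.
From mathcomp Require Import all_boot all_order all_algebra perm.
From mathcomp Require Import all_classical all_reals all_analysis.
From mathcomp Require Import interval_inference measurable_realfun ess_sup_inf.

Set Implicit Arguments.
Unset Strict Implicit.
Unset Printing Implicit Defensive.

Import Order.TTheory GRing.Theory Num.Theory.
Import numFieldNormedType.Exports.

Local Open Scope classical_set_scope.
Local Open Scope ring_scope.

(* The library's [LspaceType mu p1] (classes of p-integrable functions modulo
   equality almost everywhere) comes without algebraic structure; it is made a
   normed space here, with the operations induced by those of [LfunType mu p1]
   through the quotient map [Lclass] and with the L^p norm. *)
Section Lspace_normed.
Context d (T : measurableType d) (R : realType).
Variables (mu : {measure set T -> \bar R}) (p : \bar R) (p1 : (1 <= p)%E).
Local Notation Lfn := (LfunType mu p1).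
Local Notation Lsp := (LspaceType mu p1).
Local Notation Q := {mfun_ mu, T >-> measurableTypeR R}.
Implicit Types (f g h : Lfn) (u v w : Lsp) (a b : R).

Lemma ae_eq_Lnorm (F G : T -> R) :
  measurable_fun setT F -> measurable_fun setT G -> F = G %[ae mu] ->
  ('N[mu]_p[EFin \o F] = 'N[mu]_p[EFin \o G])%E.
Proof.
move=> mF mG FG; rewrite unlock /Lnorm; case: p p1 => [r r1|_|//].
- have m (H : T -> R) : measurable_fun setT H ->
      measurable_fun [set: T] (fun x => (`|(EFin \o H) x| `^ r)%E).
    move=> mH; apply: (measurableT_comp (measurable_poweR r)).
    by apply: measurableT_comp => //; exact/measurable_EFinP.
  congr (_ `^ _)%E; apply: ae_eq_integral => //; [exact: m|exact: m|].
  by apply: filterS FG => x /= /(_ I) -> .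
- by case: ifP => // _; apply: eq_ess_sup; apply: filterS FG => x /= /(_ I) ->.
Qed.

(* [LspaceType] is a quotient of functions into [measurableTypeR R], the Borel
   sigma-algebra of R under another display than the one used by [LfunType]. *)
Definition mfun_of_Lfun f : {mfun T >-> measurableTypeR R} :=
  HB.pack (f : T -> R) (isMeasurableFun.Build _ _ T (measurableTypeR R) f
    (@measurable_funPT _ _ _ _ f)).

Lemma repr_mfun_ae (F : {mfun T >-> measurableTypeR R}) :
  (repr (\pi_Q F)%qT : {mfun T >-> measurableTypeR R}) = F %[ae mu].
Proof.
have /eqmodP/asboolP : (\pi_Q (repr (\pi_Q F)) = \pi_Q F)%qT by rewrite reprK.
by [].
Qed.

Lemma Lclass_subproof f : finite_norm mu p (\pi_Q (mfun_of_Lfun f) : Q)%qT.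
Proof.
rewrite /finite_norm.
have -> := ae_eq_Lnorm _ _ (repr_mfun_ae (mfun_of_Lfun f)).
- exact: Lfunction_finite.
- exact: (@measurable_funPT _ _ T (measurableTypeR R) (repr (\pi_Q (mfun_of_Lfun f))%qT)).
- exact: measurable_funPT.
Qed.

Definition Lclass f : Lsp :=
  HB.pack (\pi_Q (mfun_of_Lfun f) : Q)%qT
    (isFinLebesgue.Build d T R mu p p1 _ (Lclass_subproof f)).

Lemma Lrepr_subproof u : ((u : Q) : T -> R) \in Lfun mu p.
Proof.
rewrite inE; apply/andP; split; rewrite inE /=.
- exact: (@measurable_funPT _ _ T (measurableTypeR R) (repr (u : Q))).
- exact: Lebesgue_finite.
Qed.

Definition Lrepr u : Lfn := Lfun_Sub p1 (Lrepr_subproof u).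

Lemma Lspace_inj u v : (u : Q) = (v : Q) -> u = v.
Proof.
case: u v => [u [[hu]]] [v [[hv]]] /= uv; subst v.
by rewrite (Prop_irrelevance hu hv).
Qed.

Lemma LclassP f g : Lclass f = Lclass g <-> f = g %[ae mu].
Proof.
split=> [/(congr1 (fun w : Lsp => w : Q)) /= /eqmodP/asboolP //|fg].
by apply: Lspace_inj => /=; apply/eqmodP/asboolP.
Qed.

Lemma LreprK : cancel Lrepr Lclass.
Proof.
move=> u; apply: Lspace_inj => /=; rewrite -[RHS]reprK; congr (\pi_Q _)%qT.
exact/val_inj.
Qed.

Lemma Lrepr_ae f : {ae mu, forall x, Lrepr (Lclass f) x = f x}.
Proof.
have /LclassP : Lclass (Lrepr (Lclass f)) = Lclass f by rewrite LreprK.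
by apply: filterS => x /(_ I).
Qed.

Definition Lsp_zero : Lsp := Lclass 0.
Definition Lsp_opp u : Lsp := Lclass (- Lrepr u).
Definition Lsp_add u v : Lsp := Lclass (Lrepr u + Lrepr v).
Definition Lsp_scale a u : Lsp := Lclass (a *: Lrepr u).
Definition Lsp_norm u : R := fine ('N[mu]_p[EFin \o Lrepr u])%E.

Lemma Lclass_add f g : Lsp_add (Lclass f) (Lclass g) = Lclass (f + g).
Proof.
apply/LclassP; move: (Lrepr_ae f) (Lrepr_ae g).
apply: filterS2 => x fx gx _.
by rewrite -[LHS]/(Lrepr (Lclass f) x + Lrepr (Lclass g) x) fx gx.
Qed.

Lemma Lclass_opp f : Lsp_opp (Lclass f) = Lclass (- f).
Proof.
apply/LclassP; apply: filterS (Lrepr_ae f) => x fx _.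
by rewrite -[LHS]/(- Lrepr (Lclass f) x) fx.
Qed.

Lemma Lclass_scale a f : Lsp_scale a (Lclass f) = Lclass (a *: f).
Proof.
apply/LclassP; apply: filterS (Lrepr_ae f) => x fx _.
by rewrite -[LHS]/(a * Lrepr (Lclass f) x) fx.
Qed.

Lemma Lclass_norm f : Lsp_norm (Lclass f) = fine ('N[mu]_p[EFin \o f])%E.
Proof.
rewrite /Lsp_norm (@ae_eq_Lnorm (Lrepr (Lclass f)) f) //.
by apply: filterS (Lrepr_ae f) => x.
Qed.

Lemma Lclass_surj u : exists f, u = Lclass f.
Proof. by exists (Lrepr u); rewrite LreprK. Qed.

Lemma Lsp_addA : associative Lsp_add.
Proof.
move=> u v w; have [f ->] := Lclass_surj u; have [g ->] := Lclass_surj v.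
by have [h ->] := Lclass_surj w; rewrite !Lclass_add addrA.
Qed.

Lemma Lsp_addC : commutative Lsp_add.
Proof. by move=> u v; rewrite /Lsp_add addrC. Qed.

Lemma Lsp_add0 : left_id Lsp_zero Lsp_add.
Proof. by move=> u; have [f ->] := Lclass_surj u; rewrite Lclass_add add0r. Qed.

Lemma Lsp_addN : left_inverse Lsp_zero Lsp_opp Lsp_add.
Proof.
by move=> u; have [f ->] := Lclass_surj u; rewrite Lclass_opp Lclass_add addNr.
Qed.

HB.instance Definition _ := gen_eqMixin Lsp.
HB.instance Definition _ := gen_choiceMixin Lsp.
HB.instance Definition _ :=
  GRing.isZmodule.Build Lsp Lsp_addA Lsp_addC Lsp_add0 Lsp_addN.

Lemma Lsp_scaleA a b u : Lsp_scale a (Lsp_scale b u) = Lsp_scale (a * b) u.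
Proof. by have [f ->] := Lclass_surj u; rewrite !Lclass_scale scalerA. Qed.

Lemma Lsp_scale1 : left_id 1 Lsp_scale.
Proof. by move=> u; have [f ->] := Lclass_surj u; rewrite Lclass_scale scale1r. Qed.

Lemma Lsp_scaleDr : right_distributive Lsp_scale +%R.
Proof.
move=> a u v; have [f ->] := Lclass_surj u; have [g ->] := Lclass_surj v.
by rewrite /GRing.add/= !(Lclass_scale, Lclass_add) scalerDr.
Qed.

Lemma Lsp_scaleDl u : {morph Lsp_scale^~ u : a b / a + b}.
Proof.
move=> a b; have [f ->] := Lclass_surj u.
by rewrite [RHS]/GRing.add/= !(Lclass_scale, Lclass_add) scalerDl.
Qed.

HB.instance Definition _ := GRing.Zmodule_isLmodule.Build R Lsp
  Lsp_scaleA Lsp_scale1 Lsp_scaleDr Lsp_scaleDl.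

Lemma Lsp_normD u v : Lsp_norm (u + v) <= Lsp_norm u + Lsp_norm v.
Proof. by rewrite {1}/GRing.add/= /Lsp_add Lclass_norm; exact: ler_LnormD. Qed.

Lemma Lsp_normZ a u : Lsp_norm (a *: u) = `|a| * Lsp_norm u.
Proof.
rewrite {1}/GRing.scale/= Lclass_norm; apply: EFin_inj.
by rewrite EFinM /Lsp_norm !finite_norm_fine; exact: LnormZ.
Qed.

Lemma Lsp_norm0 u : Lsp_norm u = 0 -> u = 0.
Proof. by move=> /fine_Lnormr_eq0 u0; rewrite -[LHS]LreprK; exact/LclassP. Qed.

HB.instance Definition _ :=
  Lmodule_isNormed.Build R Lsp Lsp_normD Lsp_normZ Lsp_norm0.

End Lspace_normed.

(* The finite space {0,1}^n, with the power set as sigma-algebra. *)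
Definition cube (n : nat) : Type := {ffun 'I_n -> bool}.

HB.instance Definition _ n := Finite.on (cube n).
HB.instance Definition _ n := isPointed.Build (cube n) [ffun=> false].
HB.instance Definition _ n := @isMeasurable.Build default_measure_display
  (cube n) discrete_measurable discrete_measurable0
  discrete_measurableC discrete_measurableU.

Lemma card_cube n : #|{: cube n}| = (2 ^ n)%N.
Proof. by rewrite card_ffun card_bool card_ord. Qed.

Section cube_prob.
Variables (R : realType) (n : nat).

Definition cube_prob : set (cube n) -> \bar R :=
  mscale ((2 ^+ n)^-1 : R)%:nng counting.

HB.instance Definition _ := Measure.on cube_prob.

Lemma cube_probE (A : set (cube n)) :
  cube_prob A = (#|[pred x : cube n | x \in A]|%:R / 2 ^+ n)%:E.
Proof.
have finA : finite_set A by apply: (@sub_finite_set _ _ setT) => //.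
rewrite /cube_prob /mscale /= /counting asboolT // -EFinM mulrC.
congr (_%:R / _)%:E; rewrite cardE; apply: perm_size; apply: uniq_perm => //.
  exact: enum_uniq.
by move=> x; rewrite in_fset_set// mem_enum !inE.
Qed.

Lemma cube_probT : cube_prob setT = 1%E.
Proof.
rewrite cube_probE (_ : #|_| = #|{: cube n}|); last first.
  by apply: eq_card => x; rewrite !inE; exact/mem_set.
by rewrite card_cube natrX divff// expf_neq0.
Qed.

HB.instance Definition _ := Measure_isProbability.Build _ _ _ cube_prob cube_probT.
End cube_prob.
Arguments cube_prob : clear implicits.

(* As the index set {1, 2, ...} starts at 1, the factor of index n : nat below
   is [cube n.+1]. *)
Definition cube_cylinders : set (set (forall n, cube n.+1)) :=
  \bigcup_n preimage_set_system setT (fun x => x n) measurable.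
(* The product of the spaces {0,1}^1, {0,1}^2, ... with the product
   sigma-algebra. *)
Definition Omega := g_sigma_algebraType cube_cylinders.
Definition coordinate (n : nat) (x : Omega) : cube n.+1 := x n.

(* Existence of the product measure: it is the law of the digits of a uniform
   point of [0, 1[ in the mixed radix 2^1, 2^2, ... *)
Section product_existence.
Variable R : realType.

Let b (k : nat) : nat := (2 ^ k.+1)%N.
Let M (N : nat) : nat := (\prod_(k < N) b k)%N.
Let cval k j : cube k.+1 := nth point (enum {: cube k.+1}) j.
Let digit (x : R) k : cube k.+1 := cval k (Num.trunc ((M k.+1)%:R * x) %% b k)%N.

Let b_gt0 k : (0 < b k)%N. Proof. by rewrite expn_gt0. Qed.
Let MS N : M N.+1 = (M N * b N)%N. Proof. by rewrite /M big_ord_recr. Qed.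
Let M_gt0 N : (0 < M N)%N. Proof. by rewrite prodn_gt0. Qed.

Let trunc_div (x : R) k : 0 <= x ->
  Num.trunc ((M k)%:R * x) = (Num.trunc ((M k.+1)%:R * x) %/ b k)%N.
Proof.
move=> x0; set t := Num.trunc ((M k.+1)%:R * x).
have /andP[t1 t2] : t%:R <= (M k.+1)%:R * x < t.+1%:R.
  by apply: truncn_itv; rewrite mulr_ge0.
have b0 : 0 < (b k)%:R :> R by rewrite ltr0n.
have E : (M k.+1)%:R * x = (M k)%:R * x * (b k)%:R :> R.
  by rewrite MS natrM mulrAC.
apply: truncn_def; rewrite -(ler_pM2r b0) -(ltr_pM2r b0) -E -!natrM; apply/andP; split.
  by apply: le_trans t1; rewrite ler_nat leq_divM.
by apply: lt_le_trans t2 _; rewrite ler_nat ltn_ceil.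
Qed.

Section count.
Variable A : forall n, set (cube n.+1).
Arguments A : clear implicits.

Fixpoint good (N m : nat) : bool :=
  if N is N'.+1 then good N' (m %/ b N')%N && (cval N' (m %% b N')%N \in A N')
  else true.

Let goodP N (x : R) : 0 <= x ->
  (good N (Num.trunc ((M N)%:R * x))) <-> (forall k, (k < N)%N -> A k (digit x k)).
Proof.
move=> x0; elim: N => [|N IH]; first by [].
rewrite [good _ _]/= -trunc_div//; split.
  move=> /andP[/IH h1 h2] k; rewrite ltnS leq_eqVlt => /orP[/eqP ->|/h1 //].
  exact: set_mem.
move=> h; apply/andP; split; first by apply/IH => k kN; apply: h; exact: ltnW.
by apply: mem_set; exact: h.
Qed.

Let sum_divmod a c (F : nat -> nat) :
  (\sum_(m < a * c) F m = \sum_(i < a) \sum_(j < c) F (i * c + j))%N.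
Proof.
elim: a => [|a IH]; first by rewrite mul0n !big_ord0.
rewrite big_ord_recr /= -IH mulSn addnC big_split_ord/=; congr (_ + _)%N.
Qed.

Let card_cval N : (\sum_(j < b N | cval N j \in A N) 1 =
  #|[pred x : cube N.+1 | x \in A N]|)%N.
Proof.
have sz : size (enum {: cube N.+1}) = b N by rewrite -cardE card_cube.
transitivity (\sum_(x <- enum {: cube N.+1} | x \in A N) 1)%N.
  by rewrite (big_nth point) sz big_mkord.
by rewrite big_enum_cond -sum1_card; apply: eq_bigl => x; rewrite !inE.
Qed.

Let card_good N : (\sum_(m < M N | good N m) 1 =
  \prod_(k < N) #|[pred x : cube k.+1 | x \in A k]|)%N.
Proof.
elim: N => [|N IH]; first by rewrite big_ord0 /M big_ord0 big_ord_recr big_ord0.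
rewrite [RHS]big_ord_recr/= -IH -card_cval big_distrl/= big_mkcond MS.
rewrite (sum_divmod _ _ (fun m => if good N.+1 m then 1 else 0)%N) [RHS]big_mkcond/=.
apply: eq_bigr => i _; case: ifPn => gi.
  rewrite mul1n [RHS]big_mkcond; apply: eq_bigr => j _.
  by rewrite divnMDl// divn_small// addn0 modnMDl modn_small// gi.
by rewrite big1// => j _; rewrite divnMDl// divn_small// addn0 (negbTE gi).
Qed.

Let I01 : set R := `[0, 1[.
Let mI01 : measurable I01. Proof. exact: measurable_itv. Qed.
Let itv N (m : nat) : set R := `[m%:R / (M N)%:R, m.+1%:R / (M N)%:R[.

Let itvP N m (x : R) : itv N m x <-> 0 <= x /\ Num.trunc ((M N)%:R * x) = m.
Proof.
have M0 : 0 < (M N)%:R :> R by rewrite ltr0n.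
rewrite /itv/= in_itv/= ler_pdivrMr// ltr_pdivlMr// mulrC; split.
  move=> h; split; last exact: truncn_def.
  by case/andP: h => + _ => /(le_trans (ler0n _ _)); rewrite pmulr_rge0.
by move=> [x0 <-]; apply: truncn_itv; rewrite mulr_ge0// ltW.
Qed.

Lemma good_measure N :
  lebesgue_measure ([set x : R | forall k, (k < N)%N -> A k (digit x k)] `&` I01) =
  (\prod_(k < N) cube_prob R k.+1 (A k))%E.
Proof.
have -> : [set x : R | forall k, (k < N)%N -> A k (digit x k)] `&` I01 =
   \big[setU/set0]_(m < M N | good N m) itv N m.
  rewrite -(bigcup_pred [pred i : 'I_(M N) | good N i] (fun i => itv N i)).
  apply/seteqP; split => x.
    move=> [h]; rewrite /I01/= in_itv/= => /andP[x0 x1].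
    have tM : (Num.trunc ((M N)%:R * x) < M N)%N.
      by rewrite truncn_lt_nat ?mulr_ge0// gtr_pMr// ltr0n.
    exists (Ordinal tM); last exact/itvP.
    by rewrite /= inE/=; exact/goodP.
  move=> [m /=]; rewrite inE/= => gm /itvP[x0 xm].
  split; first by apply/goodP => //; rewrite xm.
  rewrite /I01/= in_itv/= x0/=.
  have M0 : 0 < (M N)%:R :> R by rewrite ltr0n.
  by rewrite -(ltr_pM2l M0) mulr1 -truncn_lt_nat ?mulr_ge0// xm.
rewrite measure_bigsetU_ord_cond; last 2 first.
- by move=> i _; exact: measurable_itv.
- move=> i j _ _ [x [/itvP[_ xi] /itvP[_ xj]]]; apply/val_inj => /=.
  by rewrite -xi -xj.
rewrite (eq_bigr (fun=> ((M N)%:R^-1)%:E)); last first.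
  move=> i _; transitivity (@lebesgue_measure R (itv N i)); first by [].
  rewrite /itv lebesgue_measure_itv/= lte_fin ltr_pM2r ?invr_gt0 ?ltr0n//.
  by rewrite ltr_nat ltnSn -EFinB -mulrBl -natrB// subSnn mul1r.
under [RHS]eq_bigr do rewrite cube_probE.
rewrite sumEFin prodEFin; congr EFin.
rewrite big_split/= -natr_prod -card_good natr_sum mulr_suml.
apply: eq_bigr => i _; rewrite mul1r /M natr_prod -prodfV.
by apply: eq_bigr => k _; rewrite natrX.
Qed.
End count.

Let digits (x : measurableTypeR R) : Omega := digit x.

Let measurable_digits : measurable_fun setT digits.
Proof.
apply: (@measurability _ _ _ _ _ digits cube_cylinders) => [//|] _ [_ [n _ [B _ <-]] <-]; rewrite !setTI.
pose y (x : R) := (M n.+1)%:R * x.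
have -> : digits @^-1` ((fun x : Omega => x n) @^-1` B) =
  \bigcup_(m in [set m | B (cval n (m %% b n)%N)])
     (y @^-1` ([set x | Num.trunc x = m])).
  apply/seteqP; split => x /=; first by move=> h; exists (Num.trunc (y x)).
  by move=> [m /= Bm ym]; rewrite /digits /digit -/(y x) ym.
apply: bigcup_measurable => m _.
have mT : measurable [set x : R | Num.trunc x = m].
  have -> : [set x : R | Num.trunc x = m] =
      if m == 0%N then `]-oo, 1[%classic else `[m%:R, m.+1%:R[%classic.
    case: m => [|m]/=; apply/seteqP; split => x /=; rewrite in_itv/=.
    - by move/truncn0Pn; rewrite ltNge.
    - by rewrite ltNge => /truncn0Pn.
    - move=> xm; rewrite -xm; apply: truncn_itv; apply: le_trans ler01 _.
      by rewrite -truncn_gt0 xm.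
    - exact: truncn_def.
  by case: ifP => _; exact: measurable_itv.
rewrite -[X in measurable X]setTI.
by apply: (mulrl_measurable _) => //.
Qed.

Lemma product_prob_exists : exists mu : probability Omega R,
  forall (N : nat) (A : forall n, set (cube n.+1)),
   mu [set x : Omega | forall n, (n < N)%N -> A n (x n)] =
   (\prod_(n < N) cube_prob R n.+1 (A n))%E.
Proof.
pose I01 : set (measurableTypeR R) := `[0 : R, 1[%classic.
have mI01 : measurable I01 by exact: measurable_itv.
pose l01 := mrestr (@lebesgue_measure R) mI01.
have l01T : l01 setT = 1%E.
  have := @good_measure (fun=> setT) 0; rewrite big_ord0 => <-.
  rewrite /l01/= /mrestr; congr (lebesgue_measure _).
  by apply/seteqP; split => x [_ ?]; split.
pose P : probability _ R := HB.pack l01 (Measure.on l01)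
  (Measure_isProbability.Build _ _ _ l01 l01T).
pose X : {RV P >-> Omega} := HB.pack digits
  (isMeasurableFun.Build _ _ _ _ digits measurable_digits).
exists (distribution P X : probability Omega R) => N A.
by rewrite -good_measure.
Qed.
End product_existence.

(* The product probability measure; the values on finite cylinders given by
   [product_probE] determine it. *)
Definition product_prob (R : realType) : probability Omega R :=
  sval (cid (product_prob_exists R)).

Lemma product_probE (R : realType) (N : nat) (A : forall n, set (cube n.+1)) :
  product_prob R [set x : Omega | forall n, (n < N)%N -> A n (x n)] =
  (\prod_(n < N) cube_prob R n.+1 (A n))%E.
Proof. exact: (svalP (cid (product_prob_exists R))). Qed.

Lemma measurable_coordinate n : measurable_fun setT (coordinate n).
Proof.
move=> _ B _; apply: sub_sigma_algebra; exists n => //.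
by exists B.
Qed.

Lemma pushforward_coordinate (R : realType) n (B : set (cube n.+1)) :
  product_prob R (coordinate n @^-1` B) = cube_prob R n.+1 B.
Proof.
pose A k : set (cube k.+1) := [set x | forall e : k = n, B (ecast k (cube k.+1) e x)].
have -> : coordinate n @^-1` B =
    [set x : Omega | forall k, (k < n.+1)%N -> A k (x k)].
  apply/seteqP; split => [x Bx k _ e|x /(_ n (ltnSn n) erefl)//].
  by subst k.
rewrite product_probE big_ord_recr big1/= => [|i _]; last first.
  rewrite (_ : A i = setT) ?probability_setT//; apply/seteqP; split => // x _ e.
  by exfalso; have := ltn_ord i; have -> : nat_of_ord i = n := e; rewrite ltnn.
rewrite mul1e; congr (cube_prob R _ _); apply/seteqP; split => [x /(_ erefl)//|x Bx e].
by rewrite (eq_irrelevance e erefl).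
Qed.

Definition linear_span (K : pzRingType) (V : lmodType K) (A : set V) : set V :=
  [set v | exists n (a : 'I_n -> K) (w : 'I_n -> V),
    (forall i, A (w i)) /\ v = \sum_(i < n) a i *: w i].

Section subspaces.
Variables (R : realType) (p : R) (p1 : (1 <= p%:E)%E).
Local Notation Lcube n := (LspaceType (cube_prob R n) p1).
Local Notation Lomega := (LspaceType (product_prob R) p1).

Lemma Lfun_coordinate n (f : LfunType (cube_prob R n.+1) p1) :
  f \o coordinate n \in Lfun (product_prob R) p%:E.
Proof.
rewrite inE; apply/andP; split; rewrite inE/=.
  apply: (@measurableT_comp _ _ _ _ _ _ f _ (coordinate n)).
  - exact: measurable_funPT.
  - exact: measurable_coordinate.
rewrite /finite_norm.
suff -> : ('N[product_prob R]_p%:E[EFin \o (f \o coordinate n)] =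
           'N[cube_prob R n.+1]_p%:E[EFin \o f])%E by exact: Lfunction_finite.
rewrite unlock /Lnorm; congr (_ `^ _)%E.
pose g (y : cube n.+1) := (`|(EFin \o f) y| `^ p)%E.
have -> : (\int[cube_prob R n.+1]_y g y =
           \int[pushforward (product_prob R) (coordinate n)]_y g y)%E.
  apply: eq_measure_integral; first exact: measurable_coordinate.
  by move=> mc B mB BT; exact/esym/pushforward_coordinate.
rewrite ge0_integral_pushforward//; first exact: measurable_coordinate.
by move=> y _; exact: poweR_ge0.
Qed.

(* Composition with the n-th coordinate; it does not depend on the
   representative because the coordinate preserves the measure. *)
Definition Jmap n (f : Lcube n.+1) : Lomega :=
  Lclass (Lfun_Sub p1 (Lfun_coordinate (Lrepr f))).

Definition Hspace n : set (Lcube n) :=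
  [set f | (\int[cube_prob R n]_x (f x)%:E = 0)%E].

Definition Xomega : set Lomega :=
  closure (linear_span (\bigcup_n (@Jmap n @` (@Hspace n.+1)))).

Definition one_omega : Lomega :=
  Lclass (Lfun_Sub p1 (Lfun_cst (product_prob R) 1 p)).

(* The sum of the constants and of [Xomega]. *)
Definition Xhat_set : set Lomega :=
  [set v | exists (c : R) (w : Lomega), Xomega w /\ v = c *: one_omega + w].

End subspaces.

Lemma linear_span_submod (K : pzRingType) (V : lmodType K) (A : set V) :
  submod_closed (mem (linear_span A)).
Proof.
split=> [|c u v /set_mem[m [a [w [Aw ->]]]] /set_mem[n [a' [w' [Aw' ->]]]]]; apply/mem_set.
  by exists 0%N, (fun=> 0), (fun=> 0); split=> [[]//|]; rewrite big_ord0.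
exists (m + n)%N, (fun i => match fintype.split i with inl j => c * a j | inr j => a' j end),
  (fun i => match fintype.split i with inl j => w j | inr j => w' j end).
split=> [i|]; first by case: fintype.split.
rewrite big_split_ord/= scaler_sumr; congr (_ + _); apply: eq_bigr => i _.
  by rewrite (unsplitK (inl i)) scalerA.
by rewrite (unsplitK (inr i)).
Qed.

Lemma closure_submod (R : realType) (V : normedModType R) (A : set V) :
  submod_closed (mem A) -> submod_closed (mem (closure A)).
Proof.
move=> [/set_mem A0 AD]; split=> [|c u v /set_mem Au /set_mem Av]; apply/mem_set.
  exact: subset_closure.
move=> B /=; rewrite -nbhs_ballE => -[e /= e0 eB].
have c1 : 0 < `|c| + 1 by rewrite ltr_wpDl.
have e2 : 0 < e / 2 / (`|c| + 1) by rewrite !divr_gt0.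
have e2' : 0 < e / 2 by rewrite divr_gt0.
have [x [Ax ux]] := Au _ (nbhsx_ballx u _ e2).
have [y [Ay vy]] := Av _ (nbhsx_ballx v _ e2').
exists (c *: x + y); split; first by apply/set_mem/AD; exact/mem_set.
apply: eB; rewrite -ball_normE/= opprD addrACA -scalerBr.
rewrite [ltRHS]splitr; apply: le_lt_trans (ler_normD _ _) _.
apply: ler_ltD; last by move: vy; rewrite -ball_normE.
rewrite normrZ; move: ux; rewrite -ball_normE/= => /ltW ux.
apply: le_trans (ler_wpM2l _ ux) _ => //.
rewrite mulrCA ger_pMr// ler_pdivrMr// mul1r lerDl//.
Qed.

Lemma exponent_ge1 (R : realType) (p : R) : 1 < p -> (1 <= p%:E)%E.
Proof. by move=> p1; rewrite lee_fin ltW. Qed.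

Section Xhat.
Variables (R : realType) (p : R) (p1 : (1 <= p%:E)%E).
Local Notation Lomega := (LspaceType (product_prob R) p1).

Lemma Xomega_submod : submod_closed (mem (@Xomega R p p1)).
Proof. exact/closure_submod/linear_span_submod. Qed.

Lemma Xhat_submod : submod_closed (mem (@Xhat_set R p p1)).
Proof.
have [/set_mem X0 XD] := Xomega_submod.
split=> [|c u v /set_mem[a [x [Xx ->]]] /set_mem[a' [y [Xy ->]]]]; apply/mem_set.
  by exists 0, 0; rewrite scale0r addr0.
exists (c * a + a'), (c *: x + y); split; first by apply/set_mem/XD; exact/mem_set.
by rewrite scalerDr scalerDl scalerA addrACA.
Qed.

Definition Xhat_pred : {pred Lomega} := mem (@Xhat_set R p p1).

HB.instance Definition _ := GRing.isSubmodClosed.Build R Lomega Xhat_pred Xhat_submod.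

(* The unitalization as a normed space, with the norm induced by L^p. *)
Definition Xhat : Type := {v : Lomega | v \in Xhat_pred}.
HB.instance Definition _ := SubType.on Xhat.
HB.instance Definition _ := Choice.on Xhat.
HB.instance Definition _ := [SubChoice_isSubLmodule of Xhat by <:].

Lemma Xhat_normD (u v : Xhat) : `|\val (u + v)| <= `|\val u| + `|\val v|.
Proof. by rewrite raddfD; exact: ler_normD. Qed.

Lemma Xhat_normZ c (u : Xhat) : `|\val (c *: u)| = `|c| * `|\val u|.
Proof. by rewrite linearZ/=; exact: normrZ. Qed.

Lemma Xhat_norm0 (u : Xhat) : `|\val u| = 0 -> u = 0.
Proof. by move=> /normr0_eq0 u0; apply: val_inj; rewrite raddf0. Qed.

HB.instance Definition _ := Lmodule_isNormed.Build R Xhat Xhat_normD Xhat_normZ Xhat_norm0.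
End Xhat.

(* Surjective linear isometries of V onto itself; the group law is
   composition, (f * g) x = f (g x). *)
Record isometry_group (R : realType) (V : normedModType R) := Isometry {
  isometry_fun :> V -> V;
  isometry_linear : linear isometry_fun;
  isometry_norm : forall x, `|isometry_fun x| = `|x|;
  isometry_surj : forall y, exists x, isometry_fun x = y }.

Section isometry_group.
Variables (R : realType) (V : normedModType R).
Local Notation iso := (isometry_group V).
Implicit Types f g h : iso.

HB.instance Definition _ := gen_eqMixin iso.
HB.instance Definition _ := gen_choiceMixin iso.
HB.instance Definition _ f := GRing.isLinear.Build R V V _ f (isometry_linear f).

Lemma isometryP f g : f =1 g -> f = g.
Proof.
case: f g => [f fl fn fs] [g gl gn gs] /= /funext fg; subst g.
by congr Isometry; exact: Prop_irrelevance.
Qed.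

Lemma isometry_inj f : injective f.
Proof.
move=> x y fxy; apply/eqP; rewrite -subr_eq0 -normr_eq0 -(isometry_norm f).
by rewrite linearB/= fxy subrr normr0.
Qed.

Lemma isometry_one_linear : linear (@idfun V). Proof. by []. Qed.

Definition isometry_one : iso :=
  @Isometry R V idfun isometry_one_linear (fun=> erefl)
    (fun y => ex_intro _ y erefl).

Lemma isometry_mul_linear f g : linear (f \o g).
Proof. by move=> a x y /=; rewrite !linearP. Qed.

Lemma isometry_mul_norm f g x : `|(f \o g) x| = `|x|.
Proof. by rewrite /= !isometry_norm. Qed.

Lemma isometry_mul_surj f g y : exists x, (f \o g) x = y.
Proof.
have [x <-] := isometry_surj f y; have [z <-] := isometry_surj g x.
by exists z.
Qed.

Definition isometry_mul f g : iso := Isometry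
  (isometry_mul_linear f g) (isometry_mul_norm f g) (isometry_mul_surj f g).

Definition isometry_inv_fun f (y : V) : V := sval (cid (isometry_surj f y)).

Lemma isometry_invK f : cancel (isometry_inv_fun f) f.
Proof. by move=> y; exact: (svalP (cid (isometry_surj f y))). Qed.

Lemma isometry_inv_linear f : linear (isometry_inv_fun f).
Proof.
by move=> a x y; apply: (@isometry_inj f); rewrite isometry_invK isometry_linear !isometry_invK.
Qed.

Lemma isometry_inv_norm f x : `|isometry_inv_fun f x| = `|x|.
Proof. by rewrite -(isometry_norm f) isometry_invK. Qed.

Lemma isometry_inv_surj f y : exists x, isometry_inv_fun f x = y.
Proof.
by exists (f y); apply: (@isometry_inj f); exact: isometry_invK.
Qed.

Definition isometry_inv f : iso := Isometry
  (isometry_inv_linear f) (isometry_inv_norm f) (isometry_inv_surj f).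

Lemma isometry_mulA : associative isometry_mul.
Proof. by move=> f g h; exact: isometryP. Qed.

Lemma isometry_mul1 : left_id isometry_one isometry_mul.
Proof. by move=> f; exact: isometryP. Qed.

Lemma isometry_mulr1 : right_id isometry_one isometry_mul.
Proof. by move=> f; exact: isometryP. Qed.

Lemma isometry_mulV : left_inverse isometry_one isometry_inv isometry_mul.
Proof.
by move=> f; apply: isometryP => x; apply: (@isometry_inj f); exact: isometry_invK.
Qed.

Lemma isometry_mulrV : right_inverse isometry_one isometry_inv isometry_mul.
Proof. by move=> f; apply: isometryP => x; exact: isometry_invK. Qed.

HB.instance Definition _ := isGroup.Build iso isometry_mulA isometry_mul1
  isometry_mulr1 isometry_mulV isometry_mulrV.
End isometry_group.

Section product_group.
Variables (I : Type) (G : I -> groupType).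

(* The unrestricted product, with pointwise operations. *)
Definition product_group : Type := forall i, G i.

HB.instance Definition _ := gen_eqMixin product_group.
HB.instance Definition _ := gen_choiceMixin product_group.

Implicit Types x y z : product_group.
Definition product_one : product_group := fun=> 1%g.
Definition product_mul x y : product_group := fun i => (x i * y i)%g.
Definition product_inv x : product_group := fun i => (x i)^-1%g.

Lemma product_mulA : associative product_mul.
Proof. by move=> x y z; apply: functional_extensionality_dep => i; exact: mulgA. Qed.
Lemma product_mul1 : left_id product_one product_mul.
Proof. by move=> x; apply: functional_extensionality_dep => i; exact: mul1g. Qed.
Lemma product_mulr1 : right_id product_one product_mul.
Proof. by move=> x; apply: functional_extensionality_dep => i; exact: mulg1. Qed.
Lemma product_mulV : left_inverse product_one product_inv product_mul.
Proof. by move=> x; apply: functional_extensionality_dep => i; exact: mulVg. Qed.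
Lemma product_mulrV : right_inverse product_one product_inv product_mul.
Proof. by move=> x; apply: functional_extensionality_dep => i; exact: mulgV. Qed.

HB.instance Definition _ := isGroup.Build product_group product_mulA
  product_mul1 product_mulr1 product_mulV product_mulrV.
End product_group.

(* {-1, 1} under multiplication. *)
Definition sign_group : Type := {e : int | (e == 1) || (e == -1)}.
HB.instance Definition _ := SubType.on sign_group.
HB.instance Definition _ := Choice.on sign_group.

Section sign_group.
Implicit Types x y z : sign_group.

Lemma sign_mul_subproof x y :
  (\val x * \val y == 1) || (\val x * \val y == -1).
Proof.
by case/orP: (valP x) => /eqP ->; case/orP: (valP y) => /eqP ->.
Qed.

Definition sign_one : sign_group := Sub 1 isT.
Definition sign_mul x y : sign_group := Sub (\val x * \val y) (sign_mul_subproof x y).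

Lemma sign_mulA : associative sign_mul.
Proof. by move=> x y z; apply: val_inj; rewrite /= mulrA. Qed.
Lemma sign_mul1 : left_id sign_one sign_mul.
Proof. by move=> x; apply: val_inj; rewrite /= mul1r. Qed.
Lemma sign_mulr1 : right_id sign_one sign_mul.
Proof. by move=> x; apply: val_inj; rewrite /= mulr1. Qed.
Lemma sign_mulV : left_inverse sign_one id sign_mul.
Proof. by move=> x; apply: val_inj; case/orP: (valP x) => /= /eqP ->. Qed.

HB.instance Definition _ := isGroup.Build sign_group sign_mulA sign_mul1
  sign_mulr1 sign_mulV sign_mulV.
End sign_group.

(* Multiplicative bijections between groups automatically preserve 1. *)
Definition isomorphic_groups (G H : groupType) : Prop :=
  exists phi : {multiplicative G -> H}, bijective phi.

(* Main.v *)
From HB Require Import structures.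
Require Import Defs.
From mathcomp Require Import all_boot all_order all_algebra perm.
From mathcomp Require Import all_classical all_reals all_analysis.
From mathcomp Require Import measurable_realfun ring lra.

Import Order.TTheory GRing.Theory Num.Theory.
Import numFieldNormedType.Exports.

Local Open Scope classical_set_scope.
Local Open Scope ring_scope.
Set Implicit Arguments.
Unset Strict Implicit.
Unset Printing Implicit Defensive.

(** Why the theorem holds.

    For p different from 2, two functions u and v in L^p have disjoint supports
    exactly when |u+v|^p + |u-v|^p = 2 (|u|^p + |v|^p) in norm
    ([disjoint_suppP]); hence a linear isometry T of the unitalization preserves
    disjointness of supports.  The rest is an analysis of the few disjoint pairs
    that the space contains.

    Every element f has the property that changing its n-th coordinate from y to
    x changes its value by a constant depending only on f, x and y
    ([incr_exists]); f is determined up to a constant by these increments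
    ([incr0_const]), so that f is a function of the m-th coordinate as soon as
    all its other increments vanish ([only_coord]).  Let f and g be disjoint,
    with f depending on a coordinate n and g on a different coordinate m.  On a
    two by two grid of values of these coordinates f and g must then be
    supported on the two opposite diagonals, as for r + s and r - s with r and s
    independent signs ([grid]), and nothing nonzero is disjoint from both
    ([disjoint_triple]).  Therefore three or more pairwise disjoint nonzero
    elements are functions of one common coordinate ([disjoint_coord]).

    If {0,1}^N is a factor with N > 1, its 2^N >= 4 indicator functions are
    pairwise disjoint, so T maps the functions of this coordinate to functions of
    a single coordinate; comparing dimensions for T and for its inverse shows
    that it is the same coordinate ([iso_coord_pos]).  The constants are the
    functions of two different coordinates at once, so T multiplies them by some
    c with |c| = 1 ([iso_one]).  For the factor {0,1} the images of the two
    indicators are disjoint with constant sum c, which excludes the diagonal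
    configuration above ([complementary_coord]).  Hence T preserves the
    functions of each coordinate, and it maps the indicators of the points to
    disjoint functions with sum c, that is, to c times a permutation of the
    indicators ([iso_permutes]).  Conversely a sign and a permutation of each
    factor define an isometry, because permutations preserve the product
    measure; T agrees with such an isometry on functions of one coordinate, hence
    everywhere by density ([iso_ext], [standard_onto]). *)

(** * Clarkson inequalities for real numbers and their equality case *)

Section clarkson.
Variable R : realType.
Implicit Types a b q p : R.

(** Writing c^q as c * c^(q-1) and bounding both factors c^(q-1) by
    (a+b)^(q-1); the bounds are strict unless a or b vanishes. *)
Lemma powR_superadd q a b : 1 < q -> 0 <= a -> 0 <= b ->
  a `^ q + b `^ q <= (a + b) `^ q ?= iff (a * b == 0).
Proof.
move=> q1 a0 b0; have q0 : q != 0 by rewrite gt_eqF// (lt_trans _ q1).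
have [->|an0] := eqVneq a 0; first by rewrite mul0r eqxx powR0// !add0r; exact/leif_refl.
have [->|bn0] := eqVneq b 0; first by rewrite mulr0 eqxx powR0// !addr0; exact/leif_refl.
have {}a0 : 0 < a by rewrite lt_neqAle eq_sym an0.
have {}b0 : 0 < b by rewrite lt_neqAle eq_sym bn0.
have E c : 0 < c -> c `^ q = c * c `^ (q - 1).
  by move=> c0; rewrite mulr_powRB1 ?ltW// (lt_trans _ q1).
have lt : a `^ q + b `^ q < (a + b) `^ q.
  rewrite !E ?addr_gt0// mulrDl; apply: ltrD; rewrite ltr_pM2l//.
    by apply: gt0_ltr_powR; rewrite ?subr_gt0// ?nnegrE ?addr_ge0 ?ltW// ltrDl.
  by apply: gt0_ltr_powR; rewrite ?subr_gt0// ?nnegrE ?addr_ge0 ?ltW// ltrDr.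
by split; [exact: ltW|rewrite lt_eqF// mulf_eq0 (negbTE an0) (negbTE bn0)].
Qed.

Lemma powR_midpoint q s t : 1 < q -> 0 <= s -> 0 <= t ->
  ((s + t) / 2) `^ q <= (s `^ q + t `^ q) / 2.
Proof.
move=> q1 s0 t0.
have h0 : 0 <= (2^-1 : R) by lra.
have h1 : (2^-1 : R) <= 1 by lra.
have := @convex_powR R q (ltW q1) (Itv01 h0 h1) s t.
rewrite !inE/= !in_itv/= s0 t0 => /(_ isT isT).
rewrite !convRE/= => H.
have {H} : (2^-1 * s + (1 - 2^-1) * t) `^ q <= 2^-1 * s `^ q + (1 - 2^-1) * t `^ q by exact: H.
have -> : 1 - 2^-1 = 2^-1 :> R by lra.
by rewrite -!mulrDr !(mulrC 2^-1).
Qed.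

Lemma powR_half_sqr a p : `|a| `^ p = (a ^+ 2) `^ (p / 2).
Proof.
by rewrite -real_normK ?num_real// -powR_mulrn// -powRrM mulrCA mulfV ?mulr1.
Qed.

Let parallelogram a b : ((a + b) ^+ 2 + (a - b) ^+ 2) / 2 = a ^+ 2 + b ^+ 2.
Proof. by field. Qed.

(** With q = p/2 > 1, the convexity of x^q at the squares of a+b and a-b, whose
    mean is a^2 + b^2, gives twice (a^2 + b^2)^q, and superadditivity separates
    the two terms; the second step is strict unless a b = 0. *)
Lemma clarkson_gt2 p a b : 2 < p ->
  2 * (`|a| `^ p + `|b| `^ p) <= `|a + b| `^ p + `|a - b| `^ p
    ?= iff (a * b == 0).
Proof.
move=> p2; rewrite !powR_half_sqr; set q := p / 2.
have q1 : 1 < q by rewrite /q ltr_pdivlMr// mul1r.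
have Z : ((0 : R) ^+ 2) `^ q = 0.
  by rewrite expr2 mul0r powR0// gt_eqF//; lra.
have M := powR_midpoint q1 (sqr_ge0 (a + b)) (sqr_ge0 (a - b)).
have S := powR_superadd q1 (sqr_ge0 a) (sqr_ge0 b).
rewrite parallelogram in M.
split; first by move: M (S.1); lra.
have [/eqP ab0|ab0] := boolP (a * b == 0).
  have [->|->] : a = 0 \/ b = 0 by move/eqP: ab0; rewrite mulf_eq0 => /orP[]/eqP; tauto.
    by rewrite add0r sub0r sqrrN Z add0r mulr2n mulrDl mul1r eqxx.
  by rewrite addr0 subr0 Z addr0 mulr2n mulrDl mul1r eqxx.
rewrite lt_eqF//; have : (a ^+ 2) `^ q + (b ^+ 2) `^ q < (a ^+ 2 + b ^+ 2) `^ q.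
  by rewrite (lt_leif S) -exprMn sqrf_eq0.
by move: M; lra.
Qed.

(** The argument for p > 2 applied to the exponent 2/p > 1 and to the numbers
    (x^2)^(p/2) reverses all the inequalities. *)
Lemma clarkson_lt2 p a b : 0 < p -> p < 2 ->
  `|a + b| `^ p + `|a - b| `^ p <= 2 * (`|a| `^ p + `|b| `^ p)
    ?= iff (a * b == 0).
Proof.
move=> p0 p2; rewrite !powR_half_sqr; set q := p / 2.
have q0 : 0 < q by rewrite /q divr_gt0.
have q1 : 1 < q^-1 by rewrite invf_gt1// /q ltr_pdivrMr// mul1r.
have K x : 0 <= x -> (x `^ q) `^ q^-1 = x.
  by move=> x0; rewrite -powRrM mulfV ?gt_eqF// powRr1.
have K' x : 0 <= x -> (x `^ q^-1) `^ q = x.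
  by move=> x0; rewrite -powRrM mulVf ?gt_eqF// powRr1.
have Z : ((0 : R) ^+ 2) `^ q = 0.
  by rewrite expr2 mul0r powR0// gt_eqF//; lra.
have M := powR_midpoint q1 (powR_ge0 ((a + b) ^+ 2) q) (powR_ge0 ((a - b) ^+ 2) q).
have S := powR_superadd q1 (powR_ge0 (a ^+ 2) q) (powR_ge0 (b ^+ 2) q).
rewrite !K ?sqr_ge0// parallelogram in M.
rewrite !K ?sqr_ge0// mulf_eq0 !powR_eq0 !sqrf_eq0 (gt_eqF q0) !andbT -mulf_eq0 in S.
have ab0 : 0 <= a ^+ 2 + b ^+ 2 by rewrite addr_ge0 ?sqr_ge0.
have {}M : (((a + b) ^+ 2) `^ q + ((a - b) ^+ 2) `^ q) / 2 <= (a ^+ 2 + b ^+ 2) `^ q.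
  rewrite -[leLHS]K'; last by rewrite divr_ge0// addr_ge0// powR_ge0.
  by apply: ge0_ler_powR M; rewrite ?nnegrE ?powR_ge0 ?(ltW q0).
have T : (a ^+ 2 + b ^+ 2) `^ q <= (a ^+ 2) `^ q + (b ^+ 2) `^ q.
  rewrite -[leRHS]K' ?addr_ge0 ?powR_ge0//.
  by apply: ge0_ler_powR S.1; rewrite ?nnegrE ?powR_ge0 ?(ltW q0).
split; first by lra.
have [/eqP ab|ab] := boolP (a * b == 0).
  have [->|->] : a = 0 \/ b = 0 by move/eqP: ab; rewrite mulf_eq0 => /orP[]/eqP; tauto.
    by rewrite add0r sub0r sqrrN Z add0r mulr2n mulrDl mul1r eqxx.
  by rewrite addr0 subr0 Z addr0 mulr2n mulrDl mul1r eqxx.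
rewrite lt_eqF//; suff : (a ^+ 2 + b ^+ 2) `^ q < (a ^+ 2) `^ q + (b ^+ 2) `^ q by lra.
rewrite -[ltRHS]K' ?addr_ge0 ?powR_ge0//.
by apply: gt0_ltr_powR; rewrite ?nnegrE ?powR_ge0 // (lt_leif S).
Qed.
End clarkson.

(** * Disjoint supports are determined by the norm of an L^p space *)

Section Lspace_theory.
Context d (T : measurableType d) (R : realType).
Variables (mu : {measure set T -> \bar R}) (p : R) (p1 : (1 <= p%:E)%E).
Local Notation Lsp := (LspaceType mu p1).
Implicit Types u v w : Lsp.

Lemma exponent_gt0 : 0 < p.
Proof. by move: p1; rewrite lee_fin; exact: lt_le_trans. Qed.

(** An element of L^p is a class of functions; the lemmas below compute the
    chosen representative of a sum, of a multiple and so on, up to a null set. *)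
Lemma Lrepr_add u v : {ae mu, forall x, Lrepr (u + v) x = Lrepr u x + Lrepr v x}.
Proof. exact: (Lrepr_ae (Lrepr u + Lrepr v)). Qed.

Lemma Lrepr_opp u : {ae mu, forall x, Lrepr (- u) x = - Lrepr u x}.
Proof. exact: (Lrepr_ae (- Lrepr u)). Qed.

Lemma Lrepr_scale a u : {ae mu, forall x, Lrepr (a *: u) x = a * Lrepr u x}.
Proof. exact: (Lrepr_ae (a *: Lrepr u)). Qed.

Lemma Lrepr_sub u v : {ae mu, forall x, Lrepr (u - v) x = Lrepr u x - Lrepr v x}.
Proof.
by apply: filterS2 (Lrepr_add u (- v)) (Lrepr_opp v) => x -> ->.
Qed.

Lemma Lrepr_eq u v : {ae mu, forall x, Lrepr u x = Lrepr v x} -> u = v.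
Proof.
move=> uv; rewrite -[u]LreprK -[v]LreprK; apply/LclassP.
by apply: filterS uv => x + _.
Qed.

Lemma Lrepr0 : {ae mu, forall x, Lrepr (0 : Lsp) x = 0}.
Proof. exact: (Lrepr_ae 0). Qed.

Lemma measurable_Lrepr u : measurable_fun setT (Lrepr u : T -> R).
Proof. exact: measurable_funPT. Qed.

Lemma Lsp_normE u : `|u| = fine ('N[mu]_p%:E[EFin \o Lrepr u])%E.
Proof. by []. Qed.

Lemma Lsp_norm_powR u :
  (`|u| `^ p)%:E = (\int[mu]_x (`|Lrepr u x| `^ p)%:E)%E.
Proof.
have p0 : p != 0 by rewrite gt_eqF// exponent_gt0.
transitivity (('N[mu]_p%:E[EFin \o Lrepr u]) `^ p)%E.
  rewrite -poweR_EFin Lsp_normE; congr (_ `^ _)%E.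
  exact: finite_norm_fine.
by rewrite powR_Lnorm.
Qed.

Lemma integral_le_eq (A B : T -> R) :
  measurable_fun setT A -> measurable_fun setT B ->
  (forall x, 0 <= A x) -> (forall x, A x <= B x) ->
  (\int[mu]_x (A x)%:E < +oo)%E ->
  (\int[mu]_x (A x)%:E = \int[mu]_x (B x)%:E)%E ->
  {ae mu, forall x, A x = B x}.
Proof.
move=> mA mB A0 AB Aoo AeB.
have mD : measurable_fun setT (fun x => (B x - A x)%:E).
  by apply/measurable_EFinP; exact: measurable_funB.
have Afin : (\int[mu]_x (A x)%:E)%E \is a fin_num.
  by rewrite ge0_fin_numE// integral_ge0// => x _; rewrite lee_fin.
have D0 : (\int[mu]_x `|(B x - A x)%:E| = 0)%E.
  have -> : (\int[mu]_x `|(B x - A x)%:E| = \int[mu]_x (B x - A x)%:E)%E.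
    by apply: eq_integral => x _; rewrite gee0_abs// lee_fin subr_ge0.
  have : (\int[mu]_x (B x)%:E = \int[mu]_x (A x)%:E + \int[mu]_x (B x - A x)%:E)%E.
    rewrite -ge0_integralD//; first last.
    - by move=> x _; rewrite lee_fin subr_ge0.
    - exact/measurable_EFinP.
    - by move=> x _; rewrite lee_fin.
    by apply: eq_integral => x _; rewrite -EFinD addrC subrK.
  rewrite -AeB addeC => AD; move: Afin => /[dup] /(addeK (\int[mu]_x (B x - A x)%:E)) <-.
  by rewrite -AD => /subee.
have /(ae_eq_integral_abs mu measurableT mD) : (\int[mu]_x `|(B x - A x)%:E| = 0)%E by [].
apply: filterS => x /(_ I) /= [] /eqP; rewrite subr_eq0 => /eqP; exact/esym.
Qed.

Definition disjoint_supp u v := {ae mu, forall x, Lrepr u x * Lrepr v x = 0}.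

Let measurable_pow u : measurable_fun setT (fun x => `|Lrepr u x| `^ p).
Proof.
apply: (@measurableT_comp _ _ _ _ _ _ (fun y : R => y `^ p)) => //.
by apply: measurableT_comp => //; exact: measurable_Lrepr.
Qed.

Let integral_add (A B : T -> R) : measurable_fun setT A -> measurable_fun setT B ->
  (forall x, 0 <= A x) -> (forall x, 0 <= B x) ->
  (\int[mu]_x (A x + B x)%:E = \int[mu]_x (A x)%:E + \int[mu]_x (B x)%:E)%E.
Proof.
move=> mA mB A0 B0; rewrite -ge0_integralD//.
- by move=> x _; rewrite lee_fin.
- exact/measurable_EFinP.
- by move=> x _; rewrite lee_fin.
- exact/measurable_EFinP.
Qed.

Let sums u v x := `|Lrepr (u + v) x| `^ p + `|Lrepr (u - v) x| `^ p.
Let singles u v x := 2 * (`|Lrepr u x| `^ p + `|Lrepr v x| `^ p).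

Let integral_sums u v :
  (\int[mu]_x (sums u v x)%:E = (`|u + v| `^ p + `|u - v| `^ p)%:E)%E.
Proof.
by rewrite integral_add ?EFinD ?Lsp_norm_powR//; move=> x; exact: powR_ge0.
Qed.

Let integral_singles u v :
  (\int[mu]_x (singles u v x)%:E = (2 * (`|u| `^ p + `|v| `^ p))%:E)%E.
Proof.
transitivity (2%:E * \int[mu]_x (`|Lrepr u x| `^ p + `|Lrepr v x| `^ p)%:E)%E; last first.
  by rewrite integral_add ?EFinM ?EFinD ?Lsp_norm_powR// => x; exact: powR_ge0.
rewrite -ge0_integralZl//.
by apply/measurable_EFinP; exact: measurable_funD.
Qed.

Let measurable_sums u v : measurable_fun setT (sums u v).
Proof. by apply: measurable_funD. Qed.

Let measurable_singles u v : measurable_fun setT (singles u v).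
Proof. by apply: measurable_funM => //; exact: measurable_funD. Qed.

(** The two sides of the norm identity are integrals of two functions that are
    comparable at every point by the Clarkson inequality; the integrals agree
    exactly when the functions agree almost everywhere, that is, when the
    product u v vanishes almost everywhere. *)
Lemma disjoint_suppP u v : p != 2 ->
  disjoint_supp u v <->
  `|u + v| `^ p + `|u - v| `^ p = 2 * (`|u| `^ p + `|v| `^ p).
Proof.
move=> p2; have p0 := exponent_gt0.
have rep : {ae mu, forall x, sums u v x =
    `|Lrepr u x + Lrepr v x| `^ p + `|Lrepr u x - Lrepr v x| `^ p}.
  by apply: filterS2 (Lrepr_add u v) (Lrepr_sub u v) => x; rewrite /sums => -> ->.
have iff_ae : disjoint_supp u v <-> {ae mu, forall x, sums u v x = singles u v x}.
  have key (a b : R) : (a * b = 0) <->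
      (`|a + b| `^ p + `|a - b| `^ p = 2 * (`|a| `^ p + `|b| `^ p)).
    have [p2l|p2g|/eqP] := ltgtP p 2; last by rewrite (negbTE p2).
      have [_ e] := clarkson_lt2 a b p0 p2l.
      by split => [/eqP|/eqP]; [rewrite -e => /eqP|rewrite e => /eqP].
    have [_ e] := clarkson_gt2 a b p2g.
    by split => [/eqP|/esym/eqP]; [rewrite -e => /eqP/esym|rewrite e => /eqP].
  split => h; apply: filterS2 h rep => x.
    by rewrite /singles => /key <- ->.
  by rewrite /singles => + e; rewrite e => /key.
split=> [/iff_ae h|h].
  apply: EFin_inj; rewrite -integral_sums -integral_singles.
  apply: ae_eq_integral => //.
  - by apply/measurable_EFinP; exact: measurable_sums.
  - by apply/measurable_EFinP; exact: measurable_singles.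
  - by apply: filterS h => x -> _.
apply/iff_ae.
have [p2l|p2g|/eqP] := ltgtP p 2; last by rewrite (negbTE p2).
  (* The comparison holds almost everywhere only, since the representative of
     u + v is the sum of the representatives up to a null set; taking the
     maximum makes it hold everywhere. *)
  pose B x := Num.max (sums u v x) (singles u v x).
  have BE : {ae mu, forall x, singles u v x = B x}.
    apply: filterS rep => x; rewrite /B => ->; apply/esym/max_idPr.
    exact: (clarkson_lt2 _ _ p0 p2l).1.
  have : {ae mu, forall x, sums u v x = B x}.
    apply: integral_le_eq => //.
    - exact: measurable_maxr.
    - by move=> x; rewrite addr_ge0// powR_ge0.
    - by move=> x; rewrite /B le_max lexx.
    - by rewrite integral_sums ltry.
    - rewrite integral_sums h -integral_singles; apply: ae_eq_integral => //.
      + by apply/measurable_EFinP; exact: measurable_singles.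
      + by apply/measurable_EFinP; exact: measurable_maxr.
      + by apply: filterS BE => x -> _.
  by move=> h'; apply: filterS2 h' BE => x -> ->.
pose B x := Num.max (sums u v x) (singles u v x).
have BE : {ae mu, forall x, sums u v x = B x}.
  apply: filterS rep => x; rewrite /B => ->; apply/esym/max_idPl.
  exact: (clarkson_gt2 _ _ p2g).1.
have : {ae mu, forall x, singles u v x = B x}.
  apply: integral_le_eq => //.
  - exact: measurable_maxr.
  - by move=> x; rewrite mulr_ge0// addr_ge0// powR_ge0.
  - by move=> x; rewrite /B le_max lexx orbT.
  - by rewrite integral_singles ltry.
  - rewrite integral_singles -h -integral_sums; apply: ae_eq_integral => //.
    + by apply/measurable_EFinP; exact: measurable_sums.
    + by apply/measurable_EFinP; exact: measurable_maxr.
    + by apply: filterS BE => x -> _.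
by move=> h'; apply: filterS2 h' BE => x -> ->.
Qed.

End Lspace_theory.

(** * Measure-preserving maps and the action of coordinatewise permutations *)

Section composition.
Context d (T : measurableType d) (R : realType).
Variables (P : probability T R) (p : R) (p1 : (1 <= p%:E)%E).
Local Notation Lsp := (LspaceType P p1).

Lemma Lfun_bounded (f : T -> R) (C : R) : measurable_fun setT f ->
  (forall x, `|f x| <= C) -> f \in Lfun P p%:E.
Proof.
move=> mf fC; have p0 := exponent_gt0 p1.
have C0 : 0 <= C by have := fC point; exact: le_trans.
rewrite inE; apply/andP; split; rewrite inE//=.
rewrite /finite_norm unlock /Lnorm; apply: poweR_lty.
apply: (@le_lt_trans _ _ (\int[P]_x (C `^ p)%:E)%E); last first.
  rewrite integral_cst// (_ : (_ * _)%E = (C `^ p)%:E) ?ltry//.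
  by rewrite -[RHS]mule1; congr (_ * _)%E; exact: probability_setT.
apply: ge0_le_integral => //.
- by move=> x _; exact: poweR_ge0.
- apply: (@measurableT_comp _ _ _ _ _ _ (fun y : \bar R => y `^ p)%E).
    exact: measurable_poweR.
  by apply: measurableT_comp => //; exact/measurable_EFinP.
- move=> x _; rewrite lee_fin.
  by apply: ge0_ler_powR; rewrite ?nnegrE ?(ltW p0).
Qed.

Lemma aeW (Q : T -> Prop) : (forall x, Q x) -> {ae P, forall x, Q x}.
Proof. by move=> h; apply: filterE. Qed.

Lemma ae_const (Q : Prop) : {ae P, forall x : T, Q} -> Q.
Proof.
have PP : ProperFilter (almost_everywhere P).
  apply: ae_properfilter_algebraOfSetsType.
  by rewrite (_ : _ setT = 1%E) ?lte01//; exact: probability_setT.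
by move=> /filter_ex[].
Qed.

Variable phi : T -> T.
Hypothesis mphi : measurable_fun setT phi.
Hypothesis phiP : forall A, measurable A -> P (phi @^-1` A) = P A.

Lemma ae_comp (Q : T -> Prop) :
  {ae P, forall x, Q x} -> {ae P, forall x, Q (phi x)}.
Proof.
move=> [A [mA A0 QA]]; exists (phi @^-1` A); split.
- by rewrite -[X in measurable X]setTI; exact: mphi.
- by rewrite -A0; exact: phiP.
- by move=> x /= Qx; apply: QA.
Qed.

Lemma integral_comp (g : T -> \bar R) : measurable_fun setT g ->
  (forall x, 0 <= g x)%E -> (\int[P]_x g (phi x) = \int[P]_x g x)%E.
Proof.
move=> mg g0.
have -> : (\int[P]_y g y = \int[pushforward P phi]_y g y)%E.
  apply: eq_measure_integral => // A mA _; exact/esym/phiP.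
by rewrite ge0_integral_pushforward.
Qed.

Lemma Lnorm_comp (f : LfunType P p1) :
  ('N[P]_p%:E[EFin \o (f \o phi)] = 'N[P]_p%:E[EFin \o f])%E.
Proof.
rewrite unlock /Lnorm; apply: (congr1 (fun y : \bar R => y `^ p^-1)%E).
apply: (integral_comp (g := fun y => (`|(EFin \o f) y| `^ p)%E)).
  apply: (measurableT_comp (measurable_poweR p)).
  by apply: measurableT_comp => //; apply/measurable_EFinP; exact: measurable_funPT.
by move=> x; exact: poweR_ge0.
Qed.

Lemma Lfun_comp (f : LfunType P p1) : f \o phi \in Lfun P p%:E.
Proof.
rewrite inE; apply/andP; split; rewrite inE/=.
  by apply: (@measurableT_comp _ _ _ _ _ _ f) => //; exact: measurable_funPT.
by rewrite /finite_norm Lnorm_comp; exact: Lfunction_finite.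
Qed.

Definition Lcomp (u : Lsp) : Lsp := Lclass (Lfun_Sub p1 (Lfun_comp (Lrepr u))).

Lemma Lcomp_ae u : {ae P, forall x, Lrepr (Lcomp u) x = Lrepr u (phi x)}.
Proof. exact: (Lrepr_ae (Lfun_Sub p1 (Lfun_comp (Lrepr u)))). Qed.

Lemma Lcomp_linear : linear Lcomp.
Proof.
move=> a u v; apply: Lrepr_eq.
have h1 := Lcomp_ae (a *: u + v); have h2 := ae_comp (Lrepr_add (a *: u) v).
have h3 := ae_comp (Lrepr_scale a u); have h4 := Lrepr_add (a *: Lcomp u) (Lcomp v).
have h5 := Lrepr_scale a (Lcomp u); have h6 := Lcomp_ae u; have h7 := Lcomp_ae v.
near=> x.
have -> : Lrepr (Lcomp (a *: u + v)) x = Lrepr (a *: u + v) (phi x) by near: x.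
have -> : Lrepr (a *: u + v) (phi x) = Lrepr (a *: u) (phi x) + Lrepr v (phi x) by near: x.
have -> : Lrepr (a *: u) (phi x) = a * Lrepr u (phi x) by near: x.
have -> : Lrepr (a *: Lcomp u + Lcomp v) x = Lrepr (a *: Lcomp u) x + Lrepr (Lcomp v) x by near: x.
have -> : Lrepr (a *: Lcomp u) x = a * Lrepr (Lcomp u) x by near: x.
have -> : Lrepr (Lcomp u) x = Lrepr u (phi x) by near: x.
by have -> : Lrepr (Lcomp v) x = Lrepr v (phi x) by near: x.
Unshelve. all: by end_near. Qed.

Lemma Lcomp_norm u : `|Lcomp u| = `|u|.
Proof.
by rewrite [LHS]Lclass_norm [RHS]Lsp_normE; congr fine; exact: Lnorm_comp.
Qed.

End composition.

Section cube_action.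
Local Open Scope group_scope.
Variable n : nat.
Implicit Types (s t : 'S_(2 ^ n.+1)) (x : cube n.+1).

(** An explicit numbering of the points of the cube, through which the symmetric
    group on 2^(n+1) letters acts on it. *)
Definition cube_rank x : 'I_(2 ^ n.+1) := cast_ord (card_cube n.+1) (enum_rank x).
Definition cube_unrank (i : 'I_(2 ^ n.+1)) : cube n.+1 :=
  enum_val (cast_ord (esym (card_cube n.+1)) i).

Lemma cube_rankK : cancel cube_rank cube_unrank.
Proof. by move=> x; rewrite /cube_unrank cast_ordK enum_rankK. Qed.
Lemma cube_unrankK : cancel cube_unrank cube_rank.
Proof. by move=> i; rewrite /cube_rank enum_valK cast_ordKV. Qed.

Definition cube_act s x : cube n.+1 := cube_unrank (s (cube_rank x)).

Lemma cube_act1 x : cube_act 1 x = x.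
Proof. by rewrite /cube_act perm1 cube_rankK. Qed.

Lemma cube_actM s t x : cube_act (s * t) x = cube_act t (cube_act s x).
Proof. by rewrite /cube_act permM cube_unrankK. Qed.

Lemma cube_act_inj s : injective (cube_act s).
Proof.
by move=> x y /(can_inj cube_unrankK) /perm_inj /(can_inj cube_rankK).
Qed.

Lemma cube_act_tperm x y z :
  cube_act (tperm (cube_rank x) (cube_rank y)) z =
    if z == x then y else if z == y then x else z.
Proof.
have [->|zx] := eqVneq z x; first by rewrite /cube_act tpermL cube_rankK.
have [->|zy] := eqVneq z y; first by rewrite /cube_act tpermR cube_rankK.
rewrite /cube_act tpermD ?cube_rankK//.
  by apply: contra_neq zx => /(can_inj cube_rankK).
by apply: contra_neq zy => /(can_inj cube_rankK).
Qed.

Lemma cube_act_surj (f : cube n.+1 -> cube n.+1) : injective f ->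
  exists s, cube_act s =1 f.
Proof.
move=> fI; have gI : injective (cube_rank \o f \o cube_unrank).
  by move=> i j /= /(can_inj cube_rankK)/fI/(can_inj cube_unrankK).
by exists (perm gI) => x; rewrite /cube_act permE /= !cube_rankK.
Qed.

Lemma cube_act_faithful s t : cube_act s =1 cube_act t -> s = t.
Proof.
move=> st; apply/permP => i; have := st (cube_unrank i).
by rewrite /cube_act cube_unrankK => /(can_inj cube_unrankK).
Qed.
End cube_action.

Section omega_action.
Variable R : realType.
Local Notation P := (product_prob R).
Local Notation G := (product_group (fun k : nat => 'S_(2 ^ k.+1) : groupType)).
Implicit Types (a b : G).

Definition omega_act a (w : Omega) : Omega := fun n => cube_act (a n) (w n).

Lemma omega_actM a b w : omega_act (a * b)%g w = omega_act b (omega_act a w).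
Proof. by apply: functional_extensionality_dep => n; exact: cube_actM. Qed.

Lemma omega_act1 w : omega_act 1%g w = w.
Proof. by apply: functional_extensionality_dep => n; exact: cube_act1. Qed.

Lemma measurable_omega_act a : measurable_fun setT (omega_act a).
Proof.
apply: (@measurability _ _ _ _ _ (omega_act a) cube_cylinders) => [//|].
move=> _ [_ [n _ [B _ <-]] <-]; rewrite !setTI.
apply: sub_sigma_algebra; exists n => //.
by exists (cube_act (a n) @^-1` B) => //; rewrite setTI.
Qed.

Lemma cube_prob_act n s (B : set (cube n.+1)) :
  cube_prob R n.+1 (cube_act s @^-1` B) = cube_prob R n.+1 B.
Proof.
rewrite !cube_probE; congr (_%:R / _)%:E.
rewrite -(fintype.card_image (@cube_act_inj n s)); apply: eq_card => y; apply/fintype.imageP/idP.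
  move=> [x xB ->].
  have /set_mem {}xB : x \in cube_act s @^-1` B := xB.
  exact: (mem_set xB : cube_act s x \in B).
move=> yB; have /set_mem {}yB : y \in B := yB.
exists (cube_act s^-1%g y).
  suff : (cube_act s @^-1` B) (cube_act s^-1%g y) by move/mem_set.
  by rewrite /= -cube_actM mulVg cube_act1.
by rewrite -cube_actM mulVg cube_act1.
Qed.

(** The permuted measure and the product measure agree on the finite cylinders,
    which form a pi-system generating the sigma-algebra. *)
Lemma omega_act_prob a (A : set Omega) : measurable A ->
  P (omega_act a @^-1` A) = P A.
Proof.
pose X : {RV P >-> Omega} := HB.pack (omega_act a)
  (isMeasurableFun.Build _ _ _ _ (omega_act a) (measurable_omega_act a)).
pose cyl (N : nat) (B : forall n, set (cube n.+1)) :=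
  [set x : Omega | forall n, (n < N)%N -> B n (x n)].
pose C := [set D | exists N B, D = cyl N B].
move=> mA; apply: (@measure_unique _ R Omega C (fun=> setT) _ _ _ _ (distribution P X) P).
- rewrite /measurable/=; apply/seteqP; split.
    apply: smallest_sub; first exact: smallest_sigma_algebra.
    move=> _ [n _ [B _ <-]]; rewrite setTI; apply: sub_sigma_algebra.
    exists n.+1, (fun k => [set x | forall e : k = n, B (ecast k (cube k.+1) e x)]).
    apply/seteqP; split => [x Bx k _ /= e|x /(_ n (ltnSn n) erefl)//].
    by subst k.
  apply: smallest_sub; first exact: smallest_sigma_algebra.
  move=> _ [N [B ->]]; rewrite /cyl.
  have -> : [set x : Omega | forall n, (n < N)%N -> B n (x n)] =
      \bigcap_n ((fun x : Omega => x n) @^-1` (if (n < N)%N then B n else setT)).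
    apply/seteqP; split => [x h n _/=|x h n nN].
      by case: ifPn => // ?; exact: h.
    by have := h n I; rewrite /= nN.
  apply: (@bigcapT_measurable _ Omega) => n.
  apply: sub_sigma_algebra; exists n => //.
  by exists (if (n < N)%N then B n else setT) => //; rewrite setTI.
- move=> _ _ [N [B ->]] [M [D ->]].
  exists (maxn N M), (fun n => (if (n < N)%N then B n else setT) `&`
    (if (n < M)%N then D n else setT)).
  apply/seteqP; split => x /=.
    by move=> [xB xD] n _; split; case: ifPn => // ?; [exact: xB|exact: xD].
  move=> h; split => n nN.
    by have [] := h n (leq_trans nN (leq_maxl _ _)); rewrite nN.
  by have [_] := h n (leq_trans nN (leq_maxr _ _)); rewrite nN.
- by move=> _; exists 0%N, (fun=> setT); apply/seteqP; split.
- by rewrite bigcup_const.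
- have cylP N B : P (cyl N B) = (\prod_(n < N) cube_prob R n.+1 (B n))%E.
    exact: product_probE.
  move=> _ [N [B ->]].
  transitivity (P (cyl N (fun n => cube_act (a n) @^-1` B n))); first by [].
  transitivity (P (cyl N B)); last by [].
  by rewrite !cylP; apply: eq_bigr => n _; exact: cube_prob_act.
- by move=> _; apply: le_lt_trans (ltry 1); exact: probability_le1.
- exact: mA.
Qed.
End omega_action.

(** * Functions of one coordinate and the unitalization *)

Section cube_integral.
Variables (R : realType) (n : nat).
Local Notation Q := (cube_prob R n).

Lemma integral_cube (f : cube n -> R) :
  (\int[Q]_x (f x)%:E = ((\sum_x f x) / 2 ^+ n)%:E)%E.
Proof.
have ig y : Q.-integrable setT (fun x => (\1_[set y] x)%:E).
  by apply: integrable_indic.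
transitivity (\int[Q]_x \sum_(y in {: cube n}) ((f y)%:E * (\1_[set y] x)%:E))%E.
  apply: eq_integral => x _; rewrite (bigD1 x)//= big1 => [|y yx].
    by rewrite adde0 indicE mem_set// mule1.
  by rewrite indicE memNset ?mule0//= => /esym/eqP; apply/negP.
rewrite integral_sum//; last by move=> y; exact: integrableZl.
rewrite mulr_suml -sumEFin; apply: eq_bigr => y _.
rewrite integralZl// integral_indic// setIT.
rewrite EFinM; congr (_ * _)%E; rewrite [LHS]cube_probE; congr EFin.
rewrite (_ : #|_| = 1%N) ?mul1r// -(card1 y); apply: eq_card => x.
by apply/idP/eqP => [xy|->]; [exact: (set_mem (xy : x \in [set y]))|exact: mem_set].
Qed.
End cube_integral.

Section operators.
Variables (R : realType) (p : R) (p1 : (1 <= p%:E)%E).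
Local Notation P := (product_prob R).
Local Notation Lomega := (LspaceType (product_prob R) p1).
Local Notation G := (product_group (fun k : nat => 'S_(2 ^ k.+1) : groupType)).
Implicit Types (a b : G) (u v w : Lomega) (n : nat).

Definition act_op a : Lomega -> Lomega :=
  Lcomp (measurable_omega_act a) (@omega_act_prob R a).

Lemma act_op_ae a u :
  {ae P, forall x, Lrepr (act_op a u) x = Lrepr u (omega_act a x)}.
Proof. exact: Lcomp_ae. Qed.

Lemma act_op_linear a : linear (act_op a).
Proof. exact: Lcomp_linear. Qed.

HB.instance Definition _ a :=
  GRing.isLinear.Build R Lomega Lomega _ (act_op a) (act_op_linear a).

Lemma act_op_norm a u : `|act_op a u| = `|u|.
Proof. exact: Lcomp_norm. Qed.

(** The product of permutations applies its left factor first, and composition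
    with a map reverses the order, so that the action on functions is a
    homomorphism for the composition of operators. *)
Lemma act_opM a b u : act_op (a * b)%g u = act_op a (act_op b u).
Proof.
apply: Lrepr_eq.
have h1 := act_op_ae (a * b)%g u; have h2 := act_op_ae a (act_op b u).
have h3 := ae_comp (measurable_omega_act a) (@omega_act_prob R a) (act_op_ae b u).
near=> x.
have -> : Lrepr (act_op (a * b)%g u) x = Lrepr u (omega_act (a * b)%g x) by near: x.
have -> : Lrepr (act_op a (act_op b u)) x = Lrepr (act_op b u) (omega_act a x) by near: x.
have -> : Lrepr (act_op b u) (omega_act a x) = Lrepr u (omega_act b (omega_act a x)) by near: x.
by rewrite omega_actM.
Unshelve. all: by end_near. Qed.

Lemma act_op1 u : act_op 1%g u = u.
Proof.
apply: Lrepr_eq; apply: filterS (act_op_ae 1%g u) => x ->.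
by rewrite omega_act1.
Qed.

Lemma coord_Lfun n (k : cube n.+1 -> R) :
  k \o coordinate n \in Lfun P p%:E.
Proof.
apply: (@Lfun_bounded _ _ _ _ _ p1 _ (\sum_x `|k x|)).
  by apply: (@measurableT_comp _ _ _ _ _ _ k) => //; exact: measurable_coordinate.
by move=> w /=; rewrite (bigD1 (coordinate n w))//= lerDl sumr_ge0.
Qed.

Definition coord_fun n (k : cube n.+1 -> R) : Lomega :=
  Lclass (Lfun_Sub p1 (coord_Lfun k)).

Lemma coord_fun_ae n (k : cube n.+1 -> R) :
  {ae P, forall x : Omega, Lrepr (coord_fun k) x = k (x n)}.
Proof. exact: (Lrepr_ae (Lfun_Sub p1 (coord_Lfun k))). Qed.

Lemma coord_funP n (k : cube n.+1 -> R) u :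
  {ae P, forall x : Omega, Lrepr u x = k (x n)} -> u = coord_fun k.
Proof.
move=> h; apply: Lrepr_eq; apply: filterS2 h (coord_fun_ae k) => x -> ->//.
Qed.

Lemma eq_coord_fun n (k l : cube n.+1 -> R) : k =1 l -> coord_fun k = coord_fun l.
Proof. by move/funext ->. Qed.

Lemma coord_funD n (k l : cube n.+1 -> R) :
  coord_fun k + coord_fun l = coord_fun (fun x => k x + l x).
Proof.
apply: coord_funP; have h := Lrepr_add (coord_fun k) (coord_fun l).
by apply: filterS3 h (coord_fun_ae k) (coord_fun_ae l) => x -> -> ->.
Qed.

Lemma coord_funZ n c (k : cube n.+1 -> R) :
  c *: coord_fun k = coord_fun (fun x => c * k x).
Proof.
apply: coord_funP; have h := Lrepr_scale c (coord_fun k).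
by apply: filterS2 h (coord_fun_ae k) => x -> ->.
Qed.

Lemma coord_fun0 n : coord_fun (fun _ : cube n.+1 => 0 : R) = 0 :> Lomega.
Proof. by apply/esym/(@coord_funP n); exact: Lrepr0. Qed.

Lemma coord_fun_sum n I (s : seq I) (k : I -> cube n.+1 -> R) :
  \sum_(i <- s) coord_fun (k i) = coord_fun (fun x => \sum_(i <- s) k i x).
Proof.
elim: s => [|i s IH].
  by rewrite big_nil -(coord_fun0 n); apply: eq_coord_fun => x; rewrite big_nil.
by rewrite big_cons IH coord_funD; apply: eq_coord_fun => x; rewrite big_cons.
Qed.

Lemma coord_fun_one n : coord_fun (fun _ : cube n.+1 => 1) = one_omega p1 :> Lomega.
Proof.
by apply/esym/(@coord_funP n); exact: (Lrepr_ae (Lfun_Sub p1 (Lfun_cst P 1 p))).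
Qed.

Lemma coord_fun_cst n c : coord_fun (fun _ : cube n.+1 => c) = c *: one_omega p1 :> Lomega.
Proof.
rewrite -(coord_fun_one n) coord_funZ; apply: eq_coord_fun => x.
by rewrite mulr1.
Qed.

Lemma one_omega_ae c : {ae P, forall x : Omega, Lrepr (c *: one_omega p1) x = c}.
Proof. by rewrite -(coord_fun_cst 0); exact: coord_fun_ae. Qed.

Lemma act_coord_fun a n (k : cube n.+1 -> R) :
  act_op a (coord_fun k) = coord_fun (k \o cube_act (a n)).
Proof.
apply: coord_funP.
have h := ae_comp (measurable_omega_act a) (@omega_act_prob R a) (coord_fun_ae k).
by apply: filterS2 (act_op_ae a (coord_fun k)) h => x -> ->.
Qed.

Lemma act_one a : act_op a (one_omega p1) = one_omega p1.
Proof. by rewrite -(coord_fun_one 0) act_coord_fun. Qed.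

(** The generators of the space, described through genuine functions of one
    coordinate instead of classes. *)
Definition mean_zero : set Lomega :=
  [set z | exists n (k : cube n.+1 -> R), \sum_x k x = 0 /\ z = coord_fun k].

Lemma mean_zeroE : mean_zero = \bigcup_n (@Jmap R p p1 n @` (@Hspace R p p1 n.+1)).
Proof.
have e0 n : (2 ^+ n)^-1 != 0 :> R by rewrite invr_eq0 expf_neq0.
apply/seteqP; split => z.
  move=> [n [k [k0 ->]]]; exists n => //.
  have kL : k \in Lfun (cube_prob R n.+1) p%:E.
    apply: (@Lfun_bounded _ _ _ _ _ p1 _ (\sum_x `|k x|)) => // x.
    by rewrite (bigD1 x)//= lerDl sumr_ge0.
  have kae := Lrepr_ae (Lfun_Sub p1 kL : LfunType (cube_prob R n.+1) p1).
  exists (Lclass (Lfun_Sub p1 kL : LfunType (cube_prob R n.+1) p1)).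
    rewrite /Hspace/=.
    transitivity (\int[cube_prob R n.+1]_x (k x)%:E)%E; last first.
      by rewrite integral_cube k0 mul0r.
    apply: ae_eq_integral => //.
    by apply: filterS kae => x e _; exact: (congr1 EFin e).
  apply: coord_funP.
  have h := Lrepr_ae (Lfun_Sub p1 (Lfun_coordinate
    (Lrepr (Lclass (Lfun_Sub p1 kL : LfunType (cube_prob R n.+1) p1))))).
  have h' : {ae P, forall x : Omega, Lrepr (Lclass (Lfun_Sub p1 kL :
      LfunType (cube_prob R n.+1) p1)) (coordinate n x) = k (coordinate n x)}.
    case: kae => A [mA A0 QA]; exists (coordinate n @^-1` A); split.
    - by rewrite -[X in measurable X]setTI; exact: measurable_coordinate.
    - by rewrite -A0; exact: pushforward_coordinate.
    - by move=> x /= Qx; apply: QA.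
  by apply: filterS2 h h' => x -> /= ->.
move=> [n _ [f Hf <-]]; exists n, (Lrepr f); split; last first.
  by apply: coord_funP; exact: (Lrepr_ae (Lfun_Sub p1 (Lfun_coordinate (Lrepr f)))).
have : (\int[cube_prob R n.+1]_x (Lrepr f x)%:E = 0)%E by exact: Hf.
rewrite integral_cube => -[] /eqP; rewrite mulf_eq0 (negbTE (e0 _)) orbF.
by move/eqP.
Qed.

Lemma Xomega_closure w e : Xomega w -> 0 < e ->
  exists2 z, linear_span mean_zero z & `|w - z| < e.
Proof.
rewrite /Xomega -mean_zeroE => Xw e0.
have [z [sz]] := Xw _ (nbhsx_ballx w e e0).
by rewrite -ball_normE => we; exists z.
Qed.

Lemma act_mean_zero a z : mean_zero z -> mean_zero (act_op a z).
Proof.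
move=> [n [k [k0 ->]]]; exists n, (k \o cube_act (a n)); split; last exact: act_coord_fun.
by rewrite -[RHS]k0 [in RHS](reindex_inj (@cube_act_inj n (a n))).
Qed.

Lemma act_span a z : linear_span mean_zero z -> linear_span mean_zero (act_op a z).
Proof.
move=> [m [c [w [wz ->]]]]; exists m, c, (fun i => act_op a (w i)); split.
  by move=> i; exact: act_mean_zero.
by rewrite linear_sum; apply: eq_bigr => i _; rewrite linearZ.
Qed.

Lemma act_Xomega a w : Xomega w -> Xomega (act_op a w).
Proof.
move=> Xw B /=; rewrite -nbhs_ballE => -[e /= e0 eB].
have [z sz wz] := Xomega_closure Xw e0.
exists (act_op a z); split.
  by rewrite -mean_zeroE; exact: act_span.
by apply: eB; rewrite -ball_normE/= -linearB/= act_op_norm.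
Qed.

Lemma act_Xhat a v : Xhat_set v -> Xhat_set (act_op a v).
Proof.
move=> [c [w [Xw ->]]]; exists c, (act_op a w); split; first exact: act_Xomega.
by rewrite linearD linearZ/= act_one.
Qed.

(** Subtracting the mean c of k leaves a generator. *)
Lemma coord_fun_Xhat n (k : cube n.+1 -> R) : Xhat_set (coord_fun k).
Proof.
pose c := (\sum_x k x) / (2 ^ n.+1)%:R.
exists c, (coord_fun (fun x => k x - c)); split; last first.
  by rewrite -(coord_fun_cst n) coord_funD; apply: eq_coord_fun => x; rewrite addrC subrK.
apply: subset_closure; rewrite -mean_zeroE.
exists 1%N, (fun=> 1), (fun=> coord_fun (fun x => k x - c)); split.
  move=> _; exists n, (fun x => k x - c); split=> //.
  rewrite sumrB sumr_const card_cube -mulr_natr mulfVK ?subrr//.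
by rewrite big_ord1 scale1r.
Qed.
End operators.

(** * Increments in one coordinate *)

(** One-dimensional subspaces are closed: the multiples c h that are close to v
    have bounded c, and the multiples with bounded c form a compact set. *)
Lemma line_limit (R : realType) (V : normedModType R) (h v : V) :
  (forall e, 0 < e -> exists c : R, `|v - c *: h| < e) -> exists c : R, v = c *: h.
Proof.
move=> H.
have [h0|h0] := eqVneq h 0.
  exists 0; rewrite h0 scaler0; apply/eqP; rewrite -normr_eq0; apply/eqP/le_anti.
  rewrite normr_ge0 andbT; apply/ler_addgt0Pl => e /H[c].
  by rewrite h0 scaler0 subr0 addr0 => /ltW.
pose M := (`|v| + 1) / `|h|.
pose L := (fun c : R => c *: h) @` `[- M, M].
have cL : closed L.
  apply: compact_closed; first exact: norm_hausdorff.
  apply: continuous_compact; last exact: segment_compact.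
  by apply: continuous_subspaceT => c; exact: cvgZr_tmp.
have {}h0 : 0 < `|h| by rewrite normr_gt0.
suff : L v by move=> [c _ <-]; exists c.
apply: cL => B /=; rewrite -nbhs_ballE => -[e /= e0 eB].
have e1 : 0 < Num.min e 1 by rewrite lt_min e0 ltr01.
have [c] := H _ e1; rewrite lt_min => /andP[ce c1].
exists (c *: h); split; last by apply: eB; rewrite -ball_normE.
exists c => //; rewrite /= in_itv/= -ler_norml /M ler_pdivlMr// -normrZ.
rewrite -lerBlDl; apply: le_trans (ltW c1).
by rewrite distrC; exact: lerB_dist.
Qed.

Section coordinates.
Variables (R : realType) (p : R) (p1 : (1 <= p%:E)%E).
Local Notation P := (product_prob R).
Local Notation Lomega := (LspaceType (product_prob R) p1).
Local Notation G := (product_group (fun k : nat => 'S_(2 ^ k.+1) : groupType)).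
Implicit Types (u v f g h : Lomega) (n m : nat) (w : Omega).

Definition upd (w : Omega) n (x : cube n.+1) : Omega :=
  @eqtype.dfwith nat (fun k => cube k.+1) w n x.

Lemma upd_in w n (x : cube n.+1) : upd w x n = x.
Proof. by rewrite /upd eqtype.dfwith_in. Qed.

Lemma upd_out w n (x : cube n.+1) m : n != m -> upd w x m = w m.
Proof. by move=> ?; rewrite /upd eqtype.dfwith_out. Qed.

Lemma upd_id w n : upd w (w n) = w.
Proof.
apply: functional_extensionality_dep => m.
by have [e|nm] := eqVneq n m; [subst m; rewrite upd_in|rewrite upd_out].
Qed.

Lemma upd_upd w n (x y : cube n.+1) : upd (upd w x) y = upd w y.
Proof.
apply: functional_extensionality_dep => m.
by have [e|nm] := eqVneq n m; [subst m; rewrite !upd_in|rewrite !upd_out].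
Qed.

Lemma updC w n m (x : cube n.+1) (y : cube m.+1) : n != m ->
  upd (upd w x) y = upd (upd w y) x.
Proof.
move=> nm; apply: functional_extensionality_dep => k.
have [e|mk] := eqVneq m k; first by subst k; rewrite upd_in upd_out// upd_in.
rewrite (upd_out _ _ mk).
have [e|nk] := eqVneq n k; first by subst k; rewrite !upd_in.
by rewrite !upd_out.
Qed.

Definition single n (s : 'S_(2 ^ n.+1)) : G :=
  @eqtype.dfwith nat (fun k => 'S_(2 ^ k.+1)) (fun=> 1%g) n s.

Lemma single_in n (s : 'S_(2 ^ n.+1)) : single s n = s.
Proof. by rewrite /single eqtype.dfwith_in. Qed.

Lemma single_out n (s : 'S_(2 ^ n.+1)) m : n != m -> single s m = 1%g.
Proof. by move=> ?; rewrite /single eqtype.dfwith_out. Qed.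

Lemma omega_act_single n (s : 'S_(2 ^ n.+1)) (w : Omega) :
  omega_act (single s) w = upd w (cube_act s (w n)).
Proof.
apply: functional_extensionality_dep => m; rewrite /omega_act.
have [e|nm] := eqVneq n m; first by subst m; rewrite single_in upd_in.
by rewrite single_out// upd_out// cube_act1.
Qed.

Lemma act_single_out n (s : 'S_(2 ^ n.+1)) m (k : cube m.+1 -> R) : n != m ->
  act_op (single s) (coord_fun p1 k) = coord_fun p1 k.
Proof.
move=> nm; rewrite act_coord_fun; apply: eq_coord_fun => x /=.
by rewrite single_out// cube_act1.
Qed.

(** Replacing a coordinate by x does not preserve the measure, but it pulls null
    sets back to null sets: at each point it coincides with one of the finitely
    many measure-preserving transpositions of some y and x. *)
Lemma ae_upd (Q : Omega -> Prop) n (x : cube n.+1) :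
  {ae P, forall w, Q w} -> {ae P, forall w : Omega, Q (upd w x)}.
Proof.
move=> PQ; pose a (y : cube n.+1) : G := single (tperm (cube_rank y) (cube_rank x)).
have : {ae P, forall w : Omega, forall y, Q (omega_act (a y) w)}.
  apply: (@filter_forall Omega (cube n.+1 : finType) 
    (fun y w => Q (omega_act (a y) w)) (almost_everywhere P)) => y.
  exact: (ae_comp (measurable_omega_act (a y)) (@omega_act_prob R (a y))).
apply: filterS => w /(_ (w n)).
by rewrite omega_act_single cube_act_tperm eqxx.
Qed.

(** Up to a null set, f(.., x, ..) - f(.., y, ..) = c whatever the other
    coordinates are.  For f = c0 + sum_k f_k(w_k) this constant is
    f_n(x) - f_n(y). *)
Definition incr f n (x y : cube n.+1) (c : R) :=
  {ae P, forall w : Omega, Lrepr f (upd w x) - Lrepr f (upd w y) = c}.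

Lemma incr_unique f n (x y : cube n.+1) c c' :
  incr f x y c -> incr f x y c' -> c = c'.
Proof.
move=> h h'; apply: (@ae_const _ _ _ P).
by apply: filterS2 h h' => w -> ->.
Qed.

Lemma incr_sym f n (x y : cube n.+1) c : incr f x y c -> incr f y x (- c).
Proof. by apply: filterS => w <-; rewrite opprB. Qed.

Lemma incr_trans f n (x y z : cube n.+1) c c' :
  incr f x y c -> incr f y z c' -> incr f x z (c + c').
Proof. by apply: filterS2 => w <- <-; rewrite addrA subrK. Qed.

Lemma incr_lin f g n (x y : cube n.+1) a c c' :
  incr f x y c -> incr g x y c' -> incr (a *: f + g) x y (a * c + c').
Proof.
move=> hf hg.
have E : {ae P, forall w, Lrepr (a *: f + g) w = a * Lrepr f w + Lrepr g w}.
  by apply: filterS2 (Lrepr_add (a *: f) g) (Lrepr_scale a f) => w -> ->.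
have Ex := ae_upd x E; have Ey := ae_upd y E.
near=> w.
have -> : Lrepr (a *: f + g) (upd w x) = a * Lrepr f (upd w x) + Lrepr g (upd w x) by near: w.
have -> : Lrepr (a *: f + g) (upd w y) = a * Lrepr f (upd w y) + Lrepr g (upd w y) by near: w.
have <- : Lrepr f (upd w x) - Lrepr f (upd w y) = c by near: w.
have <- : Lrepr g (upd w x) - Lrepr g (upd w y) = c' by near: w.
by ring.
Unshelve. all: by end_near. Qed.

Lemma incr_coord_fun n (k : cube n.+1 -> R) x y :
  incr (coord_fun p1 k) x y (k x - k y).
Proof.
apply: filterS2 (ae_upd x (coord_fun_ae p1 k)) (ae_upd y (coord_fun_ae p1 k)) => w.
by rewrite !upd_in => -> ->.
Qed.

Lemma incr_coord_fun_out n m (k : cube m.+1 -> R) (x y : cube n.+1) : n != m ->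
  incr (coord_fun p1 k) x y 0.
Proof.
move=> nm.
apply: filterS2 (ae_upd x (coord_fun_ae p1 k)) (ae_upd y (coord_fun_ae p1 k)) => w.
by rewrite !upd_out// => -> ->; rewrite subrr.
Qed.

Lemma coord_fun_inj n (k l : cube n.+1 -> R) : coord_fun p1 k = coord_fun p1 l -> k =1 l.
Proof.
move=> kl x; apply: (@ae_const _ _ _ P).
have := ae_upd x (coord_fun_ae p1 l); rewrite -kl => h.
by apply: filterS2 h (ae_upd x (coord_fun_ae p1 k)) => w; rewrite !upd_in => ->.
Qed.

Lemma coord_fun_disjoint n (k l : cube n.+1 -> R) :
  disjoint_supp (coord_fun p1 k) (coord_fun p1 l) <-> forall x, k x * l x = 0.
Proof.
split=> [h x|h].
  apply: (@ae_const _ _ _ P).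
  apply: filterS3 (ae_upd x h) (ae_upd x (coord_fun_ae p1 k)) (ae_upd x (coord_fun_ae p1 l)) => w.
  by move=> + e e'; rewrite e e' !upd_in.
by apply: filterS2 (coord_fun_ae p1 k) (coord_fun_ae p1 l) => w -> ->.
Qed.

(** The transposition of x and y changes f only where the n-th coordinate is x
    or y; this turns the almost sure statement about increments into an equation
    in L^p, which passes to limits. *)
Lemma incr_act f n (x y : cube n.+1) c : x != y ->
  act_op (single (tperm (cube_rank x) (cube_rank y))) f - f =
    c *: coord_fun p1 (fun z => (z == x)%:R - (z == y)%:R) ->
  incr f y x c.
Proof.
move=> xy E; set a := single _ in E; set k := (fun z : cube n.+1 => _ - _) in E.
have := ae_upd x (Lrepr_sub (act_op a f) f); rewrite E => h1.
have h2 := ae_upd x (act_op_ae a f); have h3 := ae_upd x (Lrepr_scale c (coord_fun p1 k)).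
have h4 := ae_upd x (coord_fun_ae p1 k).
near=> w.
have e2 : Lrepr (act_op a f) (upd w x) = Lrepr f (omega_act a (upd w x)) by near: w.
rewrite omega_act_single upd_in cube_act_tperm eqxx upd_upd in e2.
rewrite -e2.
have <- : Lrepr (c *: coord_fun p1 k) (upd w x) =
    Lrepr (act_op a f) (upd w x) - Lrepr f (upd w x) by near: w.
have -> : Lrepr (c *: coord_fun p1 k) (upd w x) = c * Lrepr (coord_fun p1 k) (upd w x) by near: w.
have -> : Lrepr (coord_fun p1 k) (upd w x) = k (upd w x n) by near: w.
by rewrite upd_in /k eqxx (negbTE xy) subr0 mulr1.
Unshelve. all: by end_near. Qed.

Lemma incr_diag f n (x : cube n.+1) : incr f x x 0.
Proof. by apply: aeW => w; rewrite subrr. Qed.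

(** Transposing x and y in the n-th coordinate fixes the constants and the
    functions of other coordinates, and moves a function l of the n-th
    coordinate by a multiple of the difference of the indicators of y and x.
    So the displacement of any element of the span is a multiple of one fixed
    vector, and the same holds in the closure since a line is closed. *)
Lemma incr_exists f n (x y : cube n.+1) : Xhat_set f -> exists c, incr f x y c.
Proof.
have [->|yx] := eqVneq y x; first by move=> _; exists 0; exact: incr_diag.
move=> [c0 [w [Xw ->]]].
set a := single (tperm (cube_rank y) (cube_rank x)).
set k := fun z : cube n.+1 => (z == y)%:R - (z == x)%:R : R.
suff [c E] : exists c : R, act_op a w - w = c *: coord_fun p1 k.
  exists c; apply: incr_act => //; rewrite linearD linearZ/= act_one.
  by rewrite opprD addrACA subrr add0r.
apply: line_limit => e e0.
have [z [m [b [g [gz ez]]]] wz] := Xomega_closure Xw (divr_gt0 e0 (ltr0n _ 2)).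
have : exists c, act_op a z - z = c *: coord_fun p1 k.
  have gen i : exists c, act_op a (g i) - g i = c *: coord_fun p1 k.
    have [m' [l [_ ->]]] := gz i.
    have [nm|nm] := eqVneq n m'; last first.
      by exists 0; rewrite /a act_single_out// subrr scale0r.
    subst m'; exists (l x - l y).
    rewrite act_coord_fun -scaleN1r !coord_funZ coord_funD; apply: eq_coord_fun => u /=.
    rewrite /a single_in cube_act_tperm /k.
    case: (eqVneq u y) => [->|uy]; first by rewrite (negbTE yx) /=; ring.
    by case: (eqVneq u x) => [->|ux] /=; ring.
  have [c cE] := choice gen.
  exists (\sum_i b i * c i); rewrite ez linear_sum/= -sumrB scaler_suml.
  by apply: eq_bigr => i _; rewrite linearZ/= -scalerBr cE scalerA.
move=> [c ec]; exists c; rewrite -ec.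
have -> : act_op a w - w - (act_op a z - z) = act_op a (w - z) - (w - z).
  by rewrite (linearB (act_op a)) !opprD addrACA.
apply: le_lt_trans (ler_normB _ _) _; rewrite act_op_norm.
by rewrite [ltRHS]splitr ltrD.
Qed.
End coordinates.

(** * Elements with no increments are constant *)

Section averaging.
Variables (R : realType) (p : R) (p1 : (1 <= p%:E)%E).
Local Notation P := (product_prob R).
Local Notation Lomega := (LspaceType (product_prob R) p1).
Implicit Types (u v f g h : Lomega) (n m : nat).

(** The average over all permutations of the n-th coordinate, a contraction that
    kills the mean zero functions of this coordinate and fixes the functions of
    the other ones. *)
Definition avg n u : Lomega :=
  (#|{: 'S_(2 ^ n.+1)}|%:R)^-1 *: \sum_(s : 'S_(2 ^ n.+1)) act_op (single s) u.

Lemma avg_linear n : linear (avg n).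
Proof.
move=> a u v; rewrite /avg.
under eq_bigr do rewrite linearP.
by rewrite big_split/= -scaler_sumr scalerDr !scalerA mulrC.
Qed.

HB.instance Definition _ n :=
  GRing.isLinear.Build R Lomega Lomega _ (avg n) (avg_linear n).

Let perms_gt0 n : 0 < #|{: 'S_(2 ^ n.+1)}|%:R :> R.
Proof. by rewrite ltr0n; apply/card_gt0P; exists 1%g. Qed.

Lemma avg_norm n u : `|avg n u| <= `|u|.
Proof.
rewrite normrZ ger0_norm ?invr_ge0// ler_pdivrMl//.
apply: le_trans (ler_norm_sum _ _ _) _.
rewrite (eq_bigr (fun=> `|u|)) => [|s _]; last exact: act_op_norm.
by rewrite sumr_const mulr_natl.
Qed.

Lemma avg_fix n u : (forall s : 'S_(2 ^ n.+1), act_op (single s) u = u) -> avg n u = u.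
Proof.
move=> us; rewrite /avg (eq_bigr (fun=> u)) => [|s _]; last exact: us.
by rewrite sumr_const -[u *+ _]scaler_nat scalerA mulVf ?scale1r// gt_eqF.
Qed.

Lemma avg_out n m (k : cube m.+1 -> R) : n != m ->
  avg n (coord_fun p1 k) = coord_fun p1 k.
Proof. by move=> nm; apply: avg_fix => s; exact: act_single_out. Qed.

Lemma avg_in n (k : cube n.+1 -> R) : \sum_x k x = 0 -> avg n (coord_fun p1 k) = 0.
Proof.
move=> k0; rewrite /avg (eq_bigr (fun s => coord_fun p1 (k \o cube_act s))); last first.
  by move=> s _; rewrite act_coord_fun single_in.
rewrite coord_fun_sum coord_funZ -(coord_fun0 p1 n); apply: eq_coord_fun => x /=.
pose q y := \sum_(s : 'S_(2 ^ n.+1)) k (cube_act s y).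
have qE y : q y = q x.
  rewrite /q (reindex_inj (mulgI (tperm (cube_rank y) (cube_rank x)))).
  by apply: eq_bigr => s _; rewrite cube_actM cube_act_tperm eqxx.
have : \sum_y q y = 0.
  rewrite /q exchange_big big1//= => s _.
  by rewrite -[RHS]k0 [in RHS](reindex_inj (@cube_act_inj n s)).
rewrite (eq_bigr (fun=> q x)) => [|y _]; last exact: qE.
rewrite sumr_const card_cube => /eqP; rewrite mulrn_eq0 expn_eq0/=.
by move=> /eqP qx; rewrite -/(q x) qx mulr0.
Qed.

Lemma avg_mean_zero n u : mean_zero u -> mean_zero (avg n u).
Proof.
move=> [m [k [k0 ->]]]; have [e|nm] := eqVneq n m; last first.
  by rewrite avg_out//; exists m, k.
subst m; rewrite avg_in//; exists n, (fun=> 0); split; first by rewrite big1.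
by rewrite coord_fun0.
Qed.

Definition invariant_at n f := forall s : 'S_(2 ^ n.+1), act_op (single s) f = f.

(** Averaging over the coordinates of the generators in s one after the other
    leaves f unchanged, deletes the whole sum and does not increase norms. *)
Lemma invariant_dist f (s : seq Lomega) :
  (forall n, invariant_at n f) -> (forall z, z \in s -> mean_zero z) ->
  `|f| <= `|f - \sum_(z <- s) z|.
Proof.
move=> fI; have [N] := ubnP (size s); elim: N s => // N IH [|z s] /=.
  by rewrite big_nil subr0.
rewrite ltnS => sN sz.
have [n [k [k0 ez]]] : mean_zero z by apply: sz; rewrite mem_head.
apply: le_trans (avg_norm n _); rewrite big_cons linearB/= linearD/=.
rewrite [avg n z](_ : _ = 0); last first.
  by rewrite ez avg_in.
rewrite add0r avg_fix; last exact: fI.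
rewrite linear_sum/= -(big_map (avg n) xpredT id); apply: IH; first by rewrite size_map.
move=> _ /mapP[y ys ->]; apply: avg_mean_zero; apply: sz.
by rewrite in_cons ys orbT.
Qed.

Lemma incr0_invariant f n : (forall x y : cube n.+1, incr f x y 0) -> invariant_at n f.
Proof.
move=> f0 s; apply: Lrepr_eq.
have f0' : {ae P, forall w : Omega, forall x y : cube n.+1,
    Lrepr f (upd w x) - Lrepr f (upd w y) = 0}.
  apply: (@filter_forall Omega (cube n.+1 : finType) _ (almost_everywhere P)) => x.
  apply: (@filter_forall Omega (cube n.+1 : finType) _ (almost_everywhere P)) => y.
  exact: f0.
apply: filterS2 f0' (act_op_ae (single s) f) => w /(_ (cube_act s (w n)) (w n)) e ->.
by rewrite omega_act_single; apply/eqP; rewrite -subr_eq0 -[in X in _ - X](upd_id w n) e.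
Qed.

(** Without increments f is invariant under all permutations of single
    coordinates, hence so is its component g in the closed span of the
    generators.  By [invariant_dist] the norm of g is at most its distance to
    any combination of generators, which is arbitrarily small. *)
Lemma incr0_const f : Xhat_set f -> (forall n (x y : cube n.+1), incr f x y 0) ->
  exists c, f = c *: one_omega p1.
Proof.
move=> [c [g [Xg ->]]] f0; exists c.
suff -> : g = 0 by rewrite addr0.
have gI n : invariant_at n g.
  move=> s; have := incr0_invariant (f0 n) s.
  by rewrite linearD linearZ/= act_one => /addrI.
apply/eqP; rewrite -normr_eq0; apply/eqP/le_anti; rewrite normr_ge0 andbT.
apply/ler_addgt0Pl => e e0; rewrite addr0.
have [z [m [b [t [tz ->]]]] gz] := Xomega_closure Xg e0.
apply: le_trans (ltW gz).
rewrite -(big_map (fun i => b i *: t i) xpredT id); apply: invariant_dist => // _ /mapP[i _ ->].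
have [n [k [k0 ->]]] := tz i; exists n, (fun x => b i * k x); split; last exact: coord_funZ.
by rewrite -mulr_sumr k0 mulr0.
Qed.

(** The increments in the m-th coordinate define a function k of this coordinate
    such that f minus k has no increments. *)
Lemma only_coord f m : Xhat_set f ->
  (forall n (x y : cube n.+1), n != m -> incr f x y 0) ->
  exists k : cube m.+1 -> R, f = coord_fun p1 k.
Proof.
move=> Xf f0; have [k kE] := choice (fun x => incr_exists x (point : cube m.+1) Xf).
have kE2 x y : incr f x y (k x - k y) by exact: incr_trans (kE x) (incr_sym (kE y)).
pose g := -1 *: coord_fun p1 k + f.
have [c gc] : exists c, g = c *: one_omega p1.
  apply: incr0_const => [|n x y].
    rewrite -[Xhat_set _]/(Xhat_set g); have [_ XD] := Xhat_submod p1.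
    by apply/set_mem; apply: XD; apply/mem_set => //; exact: coord_fun_Xhat.
  have [e|nm] := eqVneq n m.
    subst m; rewrite (_ : 0 = -1 * (k x - k y) + (k x - k y)); last by rewrite mulN1r addNr.
    by apply: incr_lin; [exact: incr_coord_fun|exact: kE2].
  rewrite (_ : 0 = -1 * 0 + 0 :> R); last by rewrite mulr0 addr0.
  by apply: incr_lin; [exact: incr_coord_fun_out|exact: f0].
exists (fun x => k x + c); rewrite -coord_funD (coord_fun_cst p1 m) -gc /g.
by rewrite scaleN1r addrA subrr add0r.
Qed.

End averaging.

(** * Disjointly supported elements *)

(** The values on a two by two grid of two functions with disjoint supports, of
    which f has the horizontal increment c in both rows and g the vertical
    increment d in both columns.  A zero of f at one corner forces f to vanish
    at the opposite corner and g to vanish at the other two. *)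
Lemma grid_values (R : realFieldType) (f00 f01 f10 f11 g00 g01 g10 g11 c d : R) :
  c != 0 -> d != 0 ->
  f00 - f10 = c -> f01 - f11 = c -> g00 - g01 = d -> g10 - g11 = d ->
  f00 * g00 = 0 -> f01 * g01 = 0 -> f10 * g10 = 0 -> f11 * g11 = 0 ->
  [/\ f00 = 0, f11 = 0, f01 = c & f10 = - c] /\
  [/\ g01 = 0, g10 = 0, g00 = d & g11 = - d] \/
  [/\ f01 = 0, f10 = 0, f00 = c & f11 = - c] /\
  [/\ g00 = 0, g11 = 0, g01 = - d & g10 = d].
Proof.
move=> c0 d0 f0 f1 g0 g1 m00 m01 m10 m11.
have right0 (a b : R) : a * b = 0 -> a != 0 -> b = 0.
  by move=> /eqP; rewrite mulf_eq0 => /orP[/eqP ->|/eqP //]; rewrite eqxx.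
have left0 (a b : R) : a * b = 0 -> b != 0 -> a = 0 by rewrite mulrC; exact: right0.
have [f00z|f00n] := eqVneq f00 0.
  have f10E : f10 = - c by rewrite -f0 f00z sub0r opprK.
  have g10E : g10 = 0 by apply: right0 m10 _; rewrite f10E oppr_eq0.
  have g11E : g11 = - d by rewrite -g1 g10E sub0r opprK.
  have f11E : f11 = 0 by apply: left0 m11 _; rewrite g11E oppr_eq0.
  have f01E : f01 = c by rewrite -f1 f11E subr0.
  have g01E : g01 = 0 by apply: right0 m01 _; rewrite f01E.
  by left; split; split => //; rewrite -g0 g01E subr0.
have g00E : g00 = 0 by exact: right0 m00 f00n.
have g01E : g01 = - d by rewrite -g0 g00E sub0r opprK.
have f01E : f01 = 0 by apply: left0 m01 _; rewrite g01E oppr_eq0.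
have f11E : f11 = - c by rewrite -f1 f01E sub0r opprK.
have g11E : g11 = 0 by apply: right0 m11 _; rewrite f11E oppr_eq0.
have g10E : g10 = d by rewrite -g1 g11E subr0.
have f10E : f10 = 0 by apply: left0 m10 _; rewrite g10E.
by right; split; split => //; rewrite -f0 f10E subr0.
Qed.

Section disjoint_pairs.
Variables (R : realType) (p : R) (p1 : (1 <= p%:E)%E).
Local Notation P := (product_prob R).
Local Notation Lomega := (LspaceType (product_prob R) p1).
Implicit Types (u v f g h : Lomega) (n m : nat).

Definition depends f n :=
  exists (x y : cube n.+1) (c : R), c != 0 /\ incr f x y c.

Lemma depends0 f n : Xhat_set f -> ~ depends f n ->
  forall x y : cube n.+1, incr f x y 0.
Proof.
move=> Xf nd x y; have [c fc] := incr_exists x y Xf.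
have [c0|c0] := eqVneq c 0; first by rewrite -c0.
by exfalso; apply: nd; exists x, y, c.
Qed.

(** If the values of the n-th component at y and z differ, then one of them
    differs from the value at a prescribed x. *)
Lemma depends_from f n (x : cube n.+1) : Xhat_set f -> depends f n ->
  exists (y : cube n.+1) (c : R), c != 0 /\ incr f y x c.
Proof.
move=> Xf [y [z [c [c0 fc]]]].
have [a ya] := incr_exists y x Xf; have [b zb] := incr_exists z x Xf.
have [a0|a0] := eqVneq a 0; last by exists y, a.
exists z, b; split => //; apply: contra_neq c0 => b0.
apply: (incr_unique fc); rewrite -[0]addr0 -{1}a0 -[X in _ + X]oppr0 -b0.
exact: incr_trans ya (incr_sym zb).
Qed.

Lemma depends_coord_fun n m (k : cube n.+1 -> R) : depends (coord_fun p1 k) m -> m = n.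
Proof.
move=> [x [y [c [c0 kc]]]]; apply/eqP; apply: contraNT c0 => mn.
by apply/eqP; apply: (incr_unique kc); exact: incr_coord_fun_out.
Qed.

Definition updates n m (x : cube n.+1) (y : cube m.+1) (w : Omega) := upd (upd w x) y.

Lemma grid f g n m (x x' : cube n.+1) (y y' : cube m.+1) (c d : R) :
  n != m -> disjoint_supp f g ->
  c != 0 -> incr f x x' c -> d != 0 -> incr g y y' d ->
  {ae P, forall w : Omega,
   [/\ Lrepr f (updates x y w) = 0, Lrepr f (updates x' y' w) = 0,
       Lrepr f (updates x y' w) = c & Lrepr f (updates x' y w) = - c] /\
   [/\ Lrepr g (updates x y' w) = 0, Lrepr g (updates x' y w) = 0,
       Lrepr g (updates x y w) = d & Lrepr g (updates x' y' w) = - d] \/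
   [/\ Lrepr f (updates x y' w) = 0, Lrepr f (updates x' y w) = 0,
       Lrepr f (updates x y w) = c & Lrepr f (updates x' y' w) = - c] /\
   [/\ Lrepr g (updates x y w) = 0, Lrepr g (updates x' y' w) = 0,
       Lrepr g (updates x y' w) = - d & Lrepr g (updates x' y w) = d]}.
Proof.
move=> nm fg c0 fc d0 gd.
have D (a : cube n.+1) (b : cube m.+1) :
    {ae P, forall w : Omega, Lrepr f (updates a b w) * Lrepr g (updates a b w) = 0}.
  by have /(ae_upd a) := ae_upd b fg.
have F (b : cube m.+1) :
    {ae P, forall w : Omega, Lrepr f (updates x b w) - Lrepr f (updates x' b w) = c}.
  by apply: filterS (ae_upd b fc) => w <-; rewrite /updates !(updC _ _ _ nm).
have H (a : cube n.+1) :
    {ae P, forall w : Omega, Lrepr g (updates a y w) - Lrepr g (updates a y' w) = d}.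
  exact: (ae_upd a gd).
have D00 := D x y; have D01 := D x y'; have D10 := D x' y; have D11 := D x' y'.
have F0 := F y; have F1 := F y'; have H0 := H x; have H1 := H x'.
near=> w.
by apply: grid_values => //; near: w.
Unshelve. all: by end_near. Qed.

(** If n and m differed, one of f and g would be nonzero at each point of the
    grid of [grid], so that h would vanish on the grid.  If h depended on n,
    then by [grid] for the pair h, g on a grid sharing the column of x, h would
    be nonzero at x, y or at x, y'; similarly h does not depend on m, with f in
    place of g.  It does not depend on another coordinate either, as one sees by
    moving this coordinate on the grid, where h is zero.  Thus h is a constant
    that vanishes on the grid. *)
Lemma disjoint_triple f g h n m :
  Xhat_set f -> Xhat_set g -> Xhat_set h -> h <> 0 ->
  disjoint_supp f g -> disjoint_supp f h -> disjoint_supp h g ->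
  depends f n -> depends g m -> n = m.
Proof.
move=> Xf Xg Xh h0 fg fh hg [x [x' [c [c0 fc]]]] [y [y' [d [d0 gd]]]].
apply/eqP; case: (boolP (n == m)) => // nm; exfalso.
have G := grid nm fg c0 fc d0 gd.
have hz (a : cube n.+1) (b : cube m.+1) : (a == x) || (a == x') -> (b == y) || (b == y') ->
    {ae P, forall w : Omega, Lrepr h (updates a b w) = 0}.
  move=> ax byy.
  have FH := ae_upd a (ae_upd b fh); have HG := ae_upd a (ae_upd b hg).
  near=> w.
  have : Lrepr f (updates a b w) * Lrepr h (updates a b w) = 0 by near: w.
  have : Lrepr h (updates a b w) * Lrepr g (updates a b w) = 0 by near: w.
  have nz : Lrepr f (updates a b w) != 0 \/ Lrepr g (updates a b w) != 0.
    near: w; apply: filterS G => w.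
    by case/orP: ax => /eqP ->; case/orP: byy => /eqP ->;
      move=> [[[e1 e2 e3 e4] [e5 e6 e7 e8]]|[[e1 e2 e3 e4] [e5 e6 e7 e8]]];
      rewrite ?(e1, e2, e3, e4, e5, e6, e7, e8) ?oppr_eq0 ?eqxx; tauto.
  move=> /eqP + /eqP; rewrite !mulf_eq0.
  by case: nz => /negbTE ->; [move=> _ /eqP|rewrite orbF => /eqP].
have hxy := hz x y; have hxy' := hz x y'; have hx'y := hz x' y.
rewrite !eqxx ?orbT in hxy hxy' hx'y.
move: (hxy isT isT) (hxy' isT isT) (hx'y isT isT) => {}hxy {}hxy' {}hx'y.
have h_n : ~ depends h n.
  move=> /(depends_from x Xh) [z [e [e0 he]]].
  have H := grid nm hg e0 he d0 gd.
  apply: (@ae_const _ _ _ P); move: e0 => /eqP e0.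
  apply: filterS3 H hxy hxy' => w H hy hy'.
  by case: H => [[[_ _ _ E] _]|[[_ _ _ E] _]]; apply: e0; rewrite -[e]opprK -E ?hy ?hy' oppr0.
have h_m : ~ depends h m.
  move=> /(depends_from y Xh) [z [e [e0 he]]].
  have H := grid nm fh c0 fc e0 he.
  apply: (@ae_const _ _ _ P); move: e0 => /eqP e0.
  apply: filterS3 H hxy hx'y => w H hy hy'.
  by case: H => [[_ [_ _ _ E]]|[_ [_ _ E _]]]; apply: e0; rewrite -[e]opprK -E ?hy ?hy' oppr0.
have [e he] : exists e, h = e *: one_omega p1.
  apply: incr0_const => // k; apply: depends0 => // -[z [z' [e [e0 he]]]].
  have [ek|nk] := eqVneq k n; first by apply: h_n; subst k; exists z, z', e.
  have [ek|mk] := eqVneq k m; first by apply: h_m; subst k; exists z, z', e.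
  apply: (@ae_const _ _ _ P); move/eqP: e0 => e0.
  apply: filterS3 (ae_upd x (ae_upd y he)) (ae_upd z hxy) (ae_upd z' hxy) => w.
  have E (t : cube k.+1) : upd (upd (upd w x) y) t = updates x y (upd w t).
    by rewrite /updates (updC w t x nk) (updC _ t y mk).
  by rewrite !E => + hz1 hz2; rewrite hz1 hz2 subrr => /esym.
apply: h0; rewrite he; suff -> : e = 0 by rewrite scale0r.
apply: (@ae_const _ _ _ P).
have oe := ae_upd x (ae_upd y (one_omega_ae p1 e)); rewrite -he in oe.
by apply: filterS2 oe hxy => w; rewrite /updates => ->.
Unshelve. all: by end_near. Qed.

Lemma depends_some f g : Xhat_set f -> f <> 0 -> g <> 0 -> disjoint_supp f g ->
  exists n, depends f n.
Proof.
move=> Xf f0 g0 fg; apply: contrapT => nd.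
have [c fc] : exists c, f = c *: one_omega p1.
  by apply: incr0_const => // n; apply: depends0 => // fn; apply: nd; exists n.
apply: g0; apply: Lrepr_eq.
have c0 : c != 0 by apply/eqP => c0; apply: f0; rewrite fc c0 scale0r.
have oc := one_omega_ae p1 c; rewrite -fc in oc.
apply: filterS3 fg oc (Lrepr0 P p1) => w + e ->.
by rewrite e => /eqP; rewrite mulf_eq0 (negbTE c0) => /eqP.
Qed.

(** With three members at hand, [disjoint_triple] applies to any two of them and
    a third one: all of them depend on the same coordinate only. *)
Lemma disjoint_coord (I : finType) (f : I -> Lomega) : (2 < #|I|)%N ->
  (forall i, Xhat_set (f i)) -> (forall i, f i <> 0) ->
  (forall i j, i != j -> disjoint_supp (f i) (f j)) ->
  exists m, forall i, exists k : cube m.+1 -> R, f i = coord_fun p1 k.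
Proof.
move=> I3 Xf f0 fd.
have third (i j : I) : exists l, (l != i) && (l != j).
  apply/existsP; apply: contraLR I3; rewrite negb_exists => /forallP h.
  rewrite -leqNgt; apply: leq_trans (_ : (#|pred2 i j| <= 2)%N); last first.
    by rewrite card2; case: (_ == _).
  apply/subset_leq_card/fintype.subsetP => l _; have := h l.
  by rewrite negb_and !negbK.
have [i0 _] : exists i0 : I, i0 \in I by apply/card_gt0P; apply: leq_trans I3.
have [i1 /andP[i10 _]] := third i0 i0.
have same i j n m : i != j -> depends (f i) n -> depends (f j) m -> n = m.
  move=> ij; have [l /andP[li lj]] := third i j.
  apply: (disjoint_triple (h := f l)) => //; [exact: fd|apply: fd; rewrite eq_sym//|exact: fd].
have dep i : exists n, depends (f i) n.
  have [j /andP[ji _]] := third i i.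
  by apply: (@depends_some (f i) (f j)) => //; apply: fd; rewrite eq_sym.
have [m im] := dep i1.
have dep0 : forall n, depends (f i0) n -> n = m.
  by move=> n; move=> h; apply: (same i0 i1) => //; rewrite eq_sym.
have i0m : depends (f i0) m by have [n h] := dep i0; rewrite -(dep0 _ h).
exists m => i; apply: only_coord => // n x y nm.
apply: depends0 => // fn; move/negP: nm; apply; apply/eqP.
have [e|ii0] := eqVneq i i0; first by subst i; exact: dep0.
exact: (same i i0).
Qed.
End disjoint_pairs.

(** * Surjective isometries *)

Lemma eq_opp_eq0 (R : realFieldType) (a c : R) : a = c -> - a = c -> c = 0.
Proof. by move=> -> cc; lra. Qed.

Section isometries.
Variables (R : realType) (p : R) (p1 : (1 <= p%:E)%E).
Local Notation P := (product_prob R).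
Local Notation Lomega := (LspaceType (product_prob R) p1).
Local Notation G := (product_group (fun k : nat => 'S_(2 ^ k.+1) : groupType)).
Local Notation X := (Xhat p1).
Local Notation iso := (isometry_group X).
Implicit Types (n m : nat) (a b : G) (u v : X) (S T : iso).

Lemma XhatP u : Xhat_set (\val u). Proof. exact: set_mem (valP u). Qed.

Definition Xin (f : Lomega) (Xf : Xhat_set f) : X := Sub f (mem_set Xf).

Definition Xcoord n (k : cube n.+1 -> R) : X := Xin (coord_fun_Xhat p1 k).

Lemma val_Xcoord n (k : cube n.+1 -> R) : \val (Xcoord k) = coord_fun p1 k.
Proof. exact: SubK. Qed.

Lemma Xval_inj u v : \val u = \val v -> u = v. Proof. exact: val_inj. Qed.

Lemma eq_Xcoord u n (k : cube n.+1 -> R) : \val u = coord_fun p1 k -> u = Xcoord k.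
Proof. by move=> uk; apply: Xval_inj; rewrite uk val_Xcoord. Qed.

Definition indicator n (x y : cube n.+1) : R := (y == x)%:R.

Lemma XvalD u v : \val (u + v) = \val u + \val v. Proof. exact: raddfD. Qed.
Lemma XvalB u v : \val (u - v) = \val u - \val v. Proof. exact: raddfB. Qed.
Lemma XvalZ c u : \val (c *: u) = c *: \val u. Proof. exact: linearZ. Qed.
Lemma Xval_sum I (r : seq I) (F : I -> X) :
  \val (\sum_(i <- r) F i) = \sum_(i <- r) \val (F i).
Proof. exact: raddf_sum. Qed.

Lemma Xcoord_sum n (k : cube n.+1 -> R) : Xcoord k = \sum_x k x *: Xcoord (indicator x).
Proof.
apply: Xval_inj; rewrite val_Xcoord Xval_sum.
transitivity (\sum_(x : cube n.+1) coord_fun p1 (fun y => k x * indicator x y)).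
  rewrite coord_fun_sum; apply: eq_coord_fun => y.
  rewrite (bigD1 y)//= /indicator eqxx mulr1 big1 ?addr0// => x xy.
  by rewrite eq_sym (negbTE xy) mulr0.
by apply: eq_bigr => x _; rewrite XvalZ val_Xcoord coord_funZ.
Qed.

Lemma Xhat_norm u : `|u| = `|\val u|. Proof. by []. Qed.

Lemma iso_sub T u v : T (u - v) = T u - T v. Proof. exact: linearB. Qed.

(** The functions of one coordinate span a dense subspace. *)
Lemma iso_ext S T : (forall n (k : cube n.+1 -> R), S (Xcoord k) = T (Xcoord k)) -> S = T.
Proof.
move=> ST; apply: isometryP => v.
have [c [w [Xw vE]]] := XhatP v.
apply/eqP; rewrite -subr_eq0 -normr_eq0; apply/eqP/le_anti; rewrite normr_ge0 andbT.
apply/ler_addgt0Pl => e e0; rewrite addr0.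
have [z [m [b [t [tz ez]]]] wz] := Xomega_closure Xw (divr_gt0 e0 (ltr0n _ 2)).
have tX_ex i : exists x : X, \val x = t i /\ S x = T x.
  by have [n [k [_ ->]]] := tz i; exists (Xcoord k); rewrite val_Xcoord ST.
have [tX tXE] := choice tX_ex.
pose v' : X := c *: Xcoord (fun _ : cube 1 => 1) + \sum_i b i *: tX i.
have STv' : S v' = T v'.
  rewrite /v' !linearD !linearZ/= ST; congr (_ + _).
  by rewrite !linear_sum; apply: eq_bigr => i _; rewrite !linearZ/= (tXE i).2.
have vv' : `|v - v'| < e / 2.
  rewrite Xhat_norm XvalB vE XvalD XvalZ val_Xcoord coord_fun_one Xval_sum.
  rewrite (eq_bigr (fun i => b i *: t i)) => [|i _]; last by rewrite XvalZ (tXE i).1.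
  by rewrite -ez opprD addrACA subrr add0r.
have -> : S v - T v = S (v - v') - T (v - v').
  rewrite (iso_sub S v v') (iso_sub T v v') STv'.
  by move: (S v) (T v) (T v') => x y x'; rewrite opprB addrA subrK.
apply: le_trans (ler_normB _ _) _; rewrite !isometry_norm.
by rewrite [leRHS]splitr lerD// ltW.
Qed.

Definition sgn (e : sign_group) : R := (\val e)%:~R.

Lemma sgnM e e' : sgn (e * e')%g = sgn e * sgn e'.
Proof. by rewrite /sgn -intrM. Qed.

Lemma sgn_norm e : `|sgn e| = 1.
Proof. by rewrite /sgn; case/orP: (valP e) => /eqP ->; rewrite ?normrN normr1. Qed.

Lemma sgn_inj : injective sgn.
Proof. by move=> e e' /eqP; rewrite /sgn eqr_int => /eqP /val_inj. Qed.

Lemma sgn_surj c : `|c| = 1 -> exists e, sgn e = c.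
Proof.
have [c0|c0] := leP 0 c; rewrite ?(ger0_norm c0) ?(ltr0_norm c0) => c1.
  by exists 1%g; rewrite c1.
by exists (Sub (-1) isT); rewrite /sgn SubK rmorphN1 -c1 opprK.
Qed.

Definition standard_fun (e : sign_group) a u : X :=
  sgn e *: Xin (act_Xhat a (XhatP u)).

Lemma val_standard e a u : \val (standard_fun e a u) = sgn e *: act_op a (\val u).
Proof. by rewrite XvalZ SubK. Qed.

Lemma standard_linear e a : linear (standard_fun e a).
Proof.
move=> c u v; apply: Xval_inj; rewrite [LHS]val_standard [RHS]XvalD.
rewrite [X in _ = X + _]XvalZ !val_standard XvalD XvalZ.
by rewrite linearP/= scalerDr !scalerA mulrC.
Qed.

Lemma standard_norm e a u : `|standard_fun e a u| = `|u|.
Proof. by rewrite !Xhat_norm val_standard normrZ sgn_norm mul1r act_op_norm. Qed.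

Lemma standard_mul e e' a b u :
  standard_fun (e * e')%g (a * b)%g u = standard_fun e a (standard_fun e' b u).
Proof.
apply: Xval_inj; rewrite !val_standard linearZ/=.
by rewrite act_opM sgnM scalerA.
Qed.

Lemma standard_one u : standard_fun 1%g 1%g u = u.
Proof. by apply: Xval_inj; rewrite val_standard act_op1 scale1r. Qed.

Lemma standard_surj e a v : exists u, standard_fun e a u = v.
Proof.
exists (standard_fun e^-1%g a^-1%g v).
by rewrite -standard_mul !mulgV standard_one.
Qed.

Definition standard (x : sign_group * G) : iso :=
  Isometry (standard_linear x.1 x.2) (standard_norm x.1 x.2) (standard_surj x.1 x.2).

Lemma standardM x y : standard (x * y)%g = (standard x * standard y)%g.
Proof. by apply: isometryP => u; exact: standard_mul. Qed.

Lemma standard_coord x n (k : cube n.+1 -> R) :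
  \val (standard x (Xcoord k)) = sgn x.1 *: coord_fun p1 (k \o cube_act (x.2 n)).
Proof. by rewrite val_standard val_Xcoord act_coord_fun. Qed.

(** The constants detect the sign, the indicators detect the permutations. *)
Lemma standard_inj : injective standard.
Proof.
move=> [e a] [e' b] E.
have {}E n (k : cube n.+1 -> R) y : sgn e * k (cube_act (a n) y) = sgn e' * k (cube_act (b n) y).
  have := congr1 (fun S : iso => \val (S (Xcoord k))) E.
  by rewrite !standard_coord !coord_funZ => /coord_fun_inj/(_ y).
have ee : e = e' by apply: sgn_inj; have := E 0 (fun=> 1) point; rewrite !mulr1.
subst e'; congr (_, _); apply: functional_extensionality_dep => n.
apply: cube_act_faithful => y; have := E n (indicator (cube_act (a n) y)) y.
have e0 : sgn e != 0 by rewrite -normr_eq0 sgn_norm oner_eq0.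
move=> /(mulfI e0) /eqP; rewrite /indicator eqxx eqr_nat.
by case: (eqVneq (cube_act (b n) y)) => [->|].
Qed.

Hypothesis p2 : p != 2.

Lemma iso_disjoint T u v : disjoint_supp (\val u) (\val v) ->
  disjoint_supp (\val (T u)) (\val (T v)).
Proof.
move=> /(disjoint_suppP _ _ p2) uv; apply/(disjoint_suppP _ _ p2).
by rewrite -!XvalD -!XvalB -!Xhat_norm -linearB -linearD !isometry_norm.
Qed.

Lemma indicator_disjoint n (x y : cube n.+1) : x != y ->
  disjoint_supp (\val (Xcoord (indicator x))) (\val (Xcoord (indicator y))).
Proof.
move=> xy; rewrite !val_Xcoord; apply/coord_fun_disjoint => z; rewrite /indicator.
by case: eqVneq => [->|]; rewrite ?mul0r// (negbTE xy) mulr0.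
Qed.

Lemma iso_indicator_neq0 T n (x : cube n.+1) : \val (T (Xcoord (indicator x))) <> 0.
Proof.
move=> T0; have : `|Xcoord (indicator x)| = 0 by rewrite -(isometry_norm T) Xhat_norm T0 normr0.
rewrite Xhat_norm val_Xcoord => /normr0_eq0; rewrite -(coord_fun0 p1 n).
by move=> /coord_fun_inj /(_ x) /eqP; rewrite /indicator eqxx oner_eq0.
Qed.

Lemma iso_coord_ext T n m :
  (forall x : cube n.+1, exists l : cube m.+1 -> R,
    \val (T (Xcoord (indicator x))) = coord_fun p1 l) ->
  forall k : cube n.+1 -> R, exists l : cube m.+1 -> R, \val (T (Xcoord k)) = coord_fun p1 l.
Proof.
move=> /choice[l lE] k; exists (fun y => \sum_x k x * l x y).
rewrite Xcoord_sum linear_sum Xval_sum -coord_fun_sum; apply: eq_bigr => x _.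
by rewrite linearZ XvalZ lE coord_funZ.
Qed.

(** The images of the indicators are disjoint nonzero functions of one
    coordinate m; choosing a point in the support of each of them injects the
    n-th factor into the m-th one. *)
Lemma iso_block T n : (0 < n)%N -> exists m, (n <= m)%N /\
  forall k : cube n.+1 -> R, exists l : cube m.+1 -> R, \val (T (Xcoord k)) = coord_fun p1 l.
Proof.
move=> n0.
(* For n = 0 the factor has two points only, hence no triple of disjoint
   indicators. *)
have card3 : (2 < #|{: cube n.+1}|)%N by rewrite card_cube (ltn_exp2l 1).
have [m mE] := disjoint_coord card3 (fun x => XhatP (T (Xcoord (indicator x))))
  (@iso_indicator_neq0 T n) (fun x y xy => iso_disjoint T (indicator_disjoint xy)).
exists m; split; last exact: iso_coord_ext.
have [l lE] := choice mE.
have ln0 x : exists y, l x y != 0.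
  apply: contrapT => nl; apply: (@iso_indicator_neq0 T n x); rewrite lE -(coord_fun0 p1 m).
  by apply: eq_coord_fun => y; apply/eqP; apply: contrapT => /negP ly; apply: nl; exists y.
have [s sE] := choice ln0.
have sI : injective s.
  move=> x y sxy; apply/eqP; apply: contraT => xy.
  have := iso_disjoint T (indicator_disjoint xy); rewrite !lE => /coord_fun_disjoint/(_ (s x)).
  by move=> /eqP; rewrite mulf_eq0 (negbTE (sE x)) sxy (negbTE (sE y)).
by have := leq_card s sI; rewrite !card_cube leq_exp2l.
Qed.

Lemma indicator_depends n (x : cube n.+1) m (l : cube m.+1 -> R) :
  coord_fun p1 (indicator x) = coord_fun p1 l -> n = m.
Proof.
move=> E; apply: (@depends_coord_fun R p p1 m n l); rewrite -E.
have [y yx] : exists y, y != x.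
  exists [ffun i => ~~ x i]; apply/eqP => /ffunP/(_ ord0); rewrite ffunE.
  by case: (x ord0).
exists x, y, (indicator x x - indicator x y); split; last exact: incr_coord_fun.
by rewrite /indicator eqxx (negbTE yx) subr0 oner_eq0.
Qed.

(** The inverse of T maps the functions of the m-th coordinate to functions of
    some coordinate m' with n <= m <= m'; on the image of an indicator it gives
    back a function depending on n, so m' = n. *)
Lemma iso_coord_pos T n : (0 < n)%N ->
  forall k : cube n.+1 -> R, exists l : cube n.+1 -> R, \val (T (Xcoord k)) = coord_fun p1 l.
Proof.
move=> n0; have [m [nm mE]] := iso_block T n0.
have [m' [mm' mE']] := iso_block (isometry_inv T) (leq_trans n0 nm).
suff e : m = n by subst m.
have [l lE] := mE (indicator point); have [l' lE'] := mE' l.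
have Tl := eq_Xcoord lE.
have e : n = m'.
  apply: (@indicator_depends n point m' l'); rewrite -lE' -Tl -val_Xcoord; congr (\val _).
  apply: (@isometry_inj _ _ T); rewrite -[RHS]/(T (isometry_inv_fun T _)).
  by rewrite isometry_invK.
by apply/eqP; rewrite eqn_leq nm andbT e.
Qed.

(** The constants are functions of coordinate 1 and of coordinate 2, hence so is
    their image, which therefore has no increments. *)
Lemma iso_one T : exists2 c, `|c| = 1 &
  forall n, \val (T (Xcoord (fun _ : cube n.+1 => 1))) = c *: one_omega p1.
Proof.
have oneE n : Xcoord (fun _ : cube n.+1 => 1) = Xcoord (fun _ : cube 1 => 1).
  by apply: Xval_inj; rewrite !val_Xcoord !coord_fun_one.
have [l1 l1E] := @iso_coord_pos T 1 isT (fun=> 1).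
have [l2 l2E] := @iso_coord_pos T 2 isT (fun=> 1).
have [c cE] : exists c, \val (T (Xcoord (fun _ : cube 1 => 1))) = c *: one_omega p1.
  apply: incr0_const => [|n x y]; first exact: XhatP.
  have [e|n1] := eqVneq n 1%N; last by rewrite -(oneE 1) l1E; exact: incr_coord_fun_out.
  by rewrite -(oneE 2) l2E; apply: incr_coord_fun_out; rewrite e.
exists c => [|n]; last by rewrite oneE.
have one0 : `|one_omega p1 : Lomega| != 0.
  rewrite normr_eq0 -(coord_fun_one p1 0) -(coord_fun0 p1 0); apply/eqP.
  by move=> /coord_fun_inj/(_ point)/eqP; rewrite oner_eq0.
have := isometry_norm T (Xcoord (fun _ : cube 1 => 1)).
rewrite Xhat_norm cE normrZ [in RHS]Xhat_norm val_Xcoord coord_fun_one.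
by rewrite -[RHS]mul1r => /(mulIf one0).
Qed.

(** Where f and g are disjoint with sum c, the values of f are 0 and c.  If f
    depended on two coordinates then so would g = c - f, and [grid] would give f
    two opposite nonzero values. *)
Lemma complementary_coord (f g : Lomega) (c : R) : c != 0 ->
  Xhat_set f -> Xhat_set g -> disjoint_supp f g -> f + g = c *: one_omega p1 ->
  exists m (l : cube m.+1 -> R), f = coord_fun p1 l.
Proof.
move=> c0 Xf Xg fg fgc.
have gE : g = -1 *: f + c *: one_omega p1 by rewrite -fgc scaleN1r addrA addNr add0r.
have one0 n (x y : cube n.+1) : incr (c *: one_omega p1) x y 0.
  rewrite -(coord_fun_cst p1 n).
  by have := @incr_coord_fun R p p1 n (fun=> c) x y; rewrite subrr.
have fgae : {ae P, forall w : Omega, Lrepr f w + Lrepr g w = c}.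
  have oc := one_omega_ae p1 c; rewrite -fgc in oc.
  by apply: filterS2 oc (Lrepr_add f g) => w -> ->.
have uniq n m : depends f n -> depends f m -> n = m.
  move=> [x [x' [a [a0 fa]]]] [y [y' [b [b0 fb]]]].
  apply/eqP; case: (boolP (n == m)) => // nm; exfalso.
  have gb : incr g y y' (- b).
    by have := incr_lin (-1) fb (one0 m y y'); rewrite mulN1r addr0 -gE.
  have bn0 : - b != 0 by rewrite oppr_eq0.
  have H := grid nm fg a0 fa bn0 gb.
  have E (z : cube n.+1) (t : cube m.+1) := ae_upd z (ae_upd t fgae).
  apply: (@ae_const _ _ _ P); move/eqP: c0 => c0.
  have E00 := E x y; have E01 := E x y'; have E10 := E x' y; have E11 := E x' y'.
  near=> w; apply: c0.
  have e00 : Lrepr f (updates x y w) + Lrepr g (updates x y w) = c by near: w.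
  have e01 : Lrepr f (updates x y' w) + Lrepr g (updates x y' w) = c by near: w.
  have e10 : Lrepr f (updates x' y w) + Lrepr g (updates x' y w) = c by near: w.
  have e11 : Lrepr f (updates x' y' w) + Lrepr g (updates x' y' w) = c by near: w.
  have : [/\ Lrepr f (updates x y' w) = a, Lrepr f (updates x' y w) = - a,
            Lrepr g (updates x y' w) = 0 & Lrepr g (updates x' y w) = 0] \/
         [/\ Lrepr f (updates x y w) = a, Lrepr f (updates x' y' w) = - a,
            Lrepr g (updates x y w) = 0 & Lrepr g (updates x' y' w) = 0].
    near: w; apply: filterS H => w.
    by move=> [[[_ _ e1 e2] [e3 e4 _ _]]|[[_ _ e1 e2] [e3 e4 _ _]]]; [left|right].
  move=> [[h1 h2 h3 h4]|[h1 h2 h3 h4]].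
    by move: e01 e10; rewrite h1 h2 h3 h4 !addr0; exact: eq_opp_eq0.
  by move: e00 e11; rewrite h1 h2 h3 h4 !addr0; exact: eq_opp_eq0.
have [[m fm]|nf] := pselect (exists m, depends f m).
  exists m; apply: only_coord => // n x y nm; apply: depends0 => // fn.
  by move/negP: nm; apply; apply/eqP; exact: uniq.
exists 0%N; apply: only_coord => // n x y _; apply: depends0 => // fn.
by apply: nf; exists n.
Unshelve. all: by end_near. Qed.

(** The image of the indicator of x is a function of some coordinate; this is not
    a positive one, whose functions are already images of functions of the same
    coordinate. *)
Lemma iso_coord_zero T (x : cube 1) :
  exists l : cube 1 -> R, \val (T (Xcoord (indicator x))) = coord_fun p1 l.
Proof.
have [c c1 cE] := iso_one T.
have c0 : c != 0 by rewrite -normr_eq0 c1 oner_eq0.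
pose k y : R := 1 - indicator x y.
have xk : disjoint_supp (\val (T (Xcoord (indicator x)))) (\val (T (Xcoord k))).
  apply: iso_disjoint; rewrite !val_Xcoord; apply/coord_fun_disjoint => y.
  by rewrite /k /indicator; case: (y == x); rewrite ?subrr ?mulr0 ?mul0r.
have sumE : \val (T (Xcoord (indicator x))) + \val (T (Xcoord k)) = c *: one_omega p1.
  rewrite -(cE 0) -XvalD -linearD; congr (\val (T _)); apply: Xval_inj.
  rewrite XvalD !val_Xcoord coord_funD; apply: eq_coord_fun => y.
  by rewrite /k addrC subrK.
have [m [l lE]] := complementary_coord c0 (XhatP _) (XhatP _) xk sumE.
case: m l lE => [|m] l lE; first by exists l.
have [l' lE'] := @iso_coord_pos (isometry_inv T) m.+1 isT l.
have Tl := eq_Xcoord lE.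
suff : 0%N = m.+1 by [].
apply: (@indicator_depends 0 x m.+1 l'); rewrite -lE' -Tl -val_Xcoord; congr (\val _).
apply: (@isometry_inj _ _ T); rewrite -[RHS]/(T (isometry_inv_fun T _)).
by rewrite isometry_invK.
Qed.

Lemma iso_coord T n (k : cube n.+1 -> R) :
  exists l : cube n.+1 -> R, \val (T (Xcoord k)) = coord_fun p1 l.
Proof.
case: n k => [|n]; last exact: iso_coord_pos.
exact: iso_coord_ext (iso_coord_zero T).
Qed.

(** The images l x of the indicators of the n-th factor are disjoint and nonzero.
    As there are as many of them as points, each l x lives on a single point
    s x, where its value is the sum c of all of them. *)
Lemma iso_permutes T : exists2 c, `|c| = 1 & forall n, exists2 s : cube n.+1 -> cube n.+1,
  injective s & forall x, \val (T (Xcoord (indicator x))) = c *: coord_fun p1 (indicator (s x)).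
Proof.
have [c c1 cE] := iso_one T; exists c => // n.
have [l lE] := choice (fun x : cube n.+1 => iso_coord T (indicator x)).
have ln0 x : exists y, l x y != 0.
  apply: contrapT => nl; apply: (@iso_indicator_neq0 T n x); rewrite lE -(coord_fun0 p1 n).
  by apply: eq_coord_fun => y; apply/eqP; apply: contrapT => /negP ly; apply: nl; exists y.
have [s sE] := choice ln0.
have lD x y z : x != y -> l x z * l y z = 0.
  move=> xy; have := iso_disjoint T (indicator_disjoint xy).
  by rewrite !lE => /coord_fun_disjoint/(_ z).
have sI : injective s.
  move=> x y sxy; apply/eqP; apply: contraT => xy.
  have /eqP := lD _ _ (s x) xy.
  by rewrite mulf_eq0 (negbTE (sE x)) sxy (negbTE (sE y)).
have lsum y : \sum_x l x y = c.
  have : coord_fun p1 (fun y => \sum_x l x y) = coord_fun p1 (fun _ : cube n.+1 => c).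
    rewrite coord_fun_cst -(cE n) Xcoord_sum linear_sum Xval_sum -coord_fun_sum.
    by apply: eq_bigr => x _; rewrite linearZ XvalZ lE scale1r.
  by move=> /coord_fun_inj/(_ y).
have ls x y : x != y -> l x (s y) = 0.
  by move=> xy; have /eqP := lD _ _ (s y) xy; rewrite mulf_eq0 (negbTE (sE y)) orbF => /eqP.
exists s => // x; rewrite lE coord_funZ; apply: eq_coord_fun => z.
have [y ->] := fintype.codomP (injF_onto sI z).
rewrite /indicator (inj_eq sI); have [->|yx] := eqVneq y x; last by rewrite mulr0 ls// eq_sym.
by rewrite mulr1 -(lsum (s x)) (bigD1 x)//= big1 ?addr0// => y' y'x; exact: ls.
Qed.

(** The n-th permutation is inverted, since composing the indicator of x with a
    permutation gives the indicator of the preimage of x. *)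
Lemma standard_onto T : exists x, standard x = T.
Proof.
have [c c1 H] := iso_permutes T; have [e eE] := sgn_surj c1.
have K n : exists t : 'S_(2 ^ n.+1), forall x : cube n.+1,
    \val (T (Xcoord (indicator x))) = c *: coord_fun p1 (indicator (cube_act t x)).
  have [s sI sE] := H n; have [t tE] := cube_act_surj sI.
  by exists t => x; rewrite tE.
pose t n := sval (cid (K n)); have tE n := svalP (cid (K n)).
exists (e, (fun n => (t n)^-1%g) : G); apply: iso_ext => n k.
rewrite Xcoord_sum !linear_sum; apply: eq_bigr => x _; rewrite !linearZ; congr (_ *: _).
apply: Xval_inj; rewrite standard_coord tE eE; congr (_ *: _); apply: eq_coord_fun => y.
rewrite /indicator /= -(inj_eq (@cube_act_inj n (t n))) -cube_actM mulVg cube_act1.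
by [].
Qed.

End isometries.

Theorem mainTheorem6 (R : realType) (p : R) (p1 : 1 < p) (p2 : p != 2) :
  isomorphic_groups
    (isometry_group (Xhat (exponent_ge1 p1)))
    (sign_group * product_group (fun k : nat => 'S_(2 ^ k.+1) : groupType))%type.
Proof.
have onto := @standard_onto R p (exponent_ge1 p1) p2.
pose phi T := sval (cid (onto T)).
have phiK T : standard (exponent_ge1 p1) (phi T) = T := svalP (cid (onto T)).
have standardK : cancel (standard (exponent_ge1 p1)) phi.
  by move=> x; apply: (@standard_inj R p (exponent_ge1 p1)); exact: phiK.
have phiM : {morph phi : S T / (S * T)%g >-> (S * T)%g}.
  by move=> S T; rewrite -[in LHS](phiK S) -[in LHS](phiK T) -standardM standardK.
pose morphism : {multiplicative isometry_group (Xhat (exponent_ge1 p1)) ->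
    sign_group * product_group (fun k : nat => 'S_(2 ^ k.+1) : groupType)} :=
  HB.pack phi (isMultiplicative.Build _ _ phi phiM).
exists morphism.
by exists (standard (exponent_ge1 p1)).
Qed.
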